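(* Let $S$ be a separable $\Bbbk$-algebra over a field $\Bbbk$ and let $A$ denote a graded quotient of the polynomial ring $T:=S[X_1,\dots,X_n]$. Assume that $R\subseteq T^{\ge2}$ is a bimodule of relations for $A$ and that $R_P=R$, for some $S$-subbimodule $P\subseteq T$. Then $P$ is of PBW-type if and only if either $c(A)=-1$ or $P$ satisfies the Jacobi conditions $(\mathcal J_k)$ for $1\le k\le c(A)$.
   Context: $S$-bimodules are left modules over $S\otimes_{\Bbbk}S^{op}$; $S$ is separable if it is projective as an $S$-bimodule. In $T=S[X_1,\dots,X_n]$ the indeterminates commute with each other and with $S$; $T$ is graded by total degree with $T^0=S$. $p^m:T\to T^m$ is the projection, $T^{\le m}=\bigoplus_{q\le m}T^q$, $T^{\ge m}=\bigoplus_{q\ge m}T^q$, $Y^{\le m}=Y\cap T^{\le m}$, $\langle Y\rangle$ the two-sided ideal generated by $Y$. Write $A=T/I$ with $I$ a graded ideal. A bimodule of relations for $A=T/I$ (relative to $T$) is a graded $S$-subbimodule $R\subseteq I$ with $I=R\oplus(T^1I+IT^1)$ (it then generates $I$). For an $S$-subbimodule $P\subseteq T$: $R_P:=\bigoplus_mp^m(P^{\le m})$; $U(P):=T/\langle P\rangle$, filtered by the images of $T^{\le m}$. $P$ is of PBW-type if the graded $S$-ring map $\Phi_P:T/\langle R_P\rangle\to\operatorname{gr}U(P)$, $x+\langle R_P\rangle\mapsto(x+\langle P\rangle)+U(P)^{\le m-1}$ ($x\in T^m$), is an isomorphism. $(\mathcal J_k)$: $P_{k+1}\cap T^{\le k}\subseteq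 P_k$, where $P_k:=\sum_{i+j+l=k}T^{\le i}P^{\le j}T^{\le l}$. $c(A)=-1$ if $\operatorname{Tor}_3^A(S,S)=0$, otherwise $c(A)=\sup\{m-1\mid\operatorname{Tor}^A_{3,m}(S,S)\ne0\}$, with $m$ the internal degree (if $c(A)=\infty$ all $(\mathcal J_k)$, $k\ge1$, are required). *)

(* Defs.v *)
From HB Require Import structures.
From mathcomp Require Import all_boot all_order all_algebra.
From mathcomp Require Import boolp.
From mathcomp Require Import freeg mpoly.

Set Implicit Arguments.
Unset Strict Implicit.
Unset Printing Implicit Defensive.

Import GRing.Theory.
Local Open Scope ring_scope.
Local Open Scope quotient_scope.

Inductive subgroup_spec (V : zmodType) (Y : V -> Prop) : V -> Prop :=
  | Subgroup0 : subgroup_spec Y 0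
  | SubgroupGen y : Y y -> subgroup_spec Y y
  | SubgroupB x y :
      subgroup_spec Y x -> subgroup_spec Y y -> subgroup_spec Y (x - y).

Definition subgroup_of (V : zmodType) (Y : V -> Prop) : {pred V} :=
  fun x => `[< subgroup_spec Y x >].

Lemma subgroup_of_zmod_closed (V : zmodType) (Y : V -> Prop) :
  zmod_closed (subgroup_of Y).
Proof.
split=> [|x y /asboolP hx /asboolP hy]; apply/asboolP; first exact: Subgroup0.
exact: SubgroupB.
Qed.

HB.instance Definition _ (V : zmodType) (Y : V -> Prop) :=
  GRing.isZmodClosed.Build V (subgroup_of Y) (subgroup_of_zmod_closed Y).

(* The library's [idealr] are proper and only have quotients in the commutative
   case; here the ideals are two-sided and may contain 1. *)
HB.mixin Record isTwoSided (R : nzRingType) (I : R -> bool) := {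
  ideal_mull : forall a x, x \in I -> a * x \in I;
  ideal_mulr : forall x a, x \in I -> x * a \in I
}.

#[short(type="twoSidedIdeal")]
HB.structure Definition TwoSidedIdeal (R : nzRingType) :=
  {I of GRing.ZmodClosed R I & isTwoSided R I}.

Definition quor (R : nzRingType) (I : twoSidedIdeal R) := Quotient.quot I.

Section QuotientRing.
Variables (R : nzRingType) (I : twoSidedIdeal R).

HB.instance Definition _ := GRing.Zmodule.on (quor I).
HB.instance Definition _ := Quotient.on (quor I).

Definition quor_mul (a b : quor I) : quor I := \pi_(quor I) (repr a * repr b).

Lemma quor_eqP (x y : R) :
  reflect (\pi_(quor I) x = \pi_(quor I) y) (x - y \in I).
Proof.
apply: (iffP idP) => [h|/eqP]; last by rewrite -Quotient.idealrBE.
by apply/eqP; rewrite -Quotient.idealrBE.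
Qed.

Lemma quor_pi_mul (x y : R) :
  \pi_(quor I) (x * y) = quor_mul (\pi x) (\pi y).
Proof.
apply/quor_eqP; set x' := repr _; set y' := repr _.
have hx : x - x' \in I by apply/quor_eqP; rewrite reprK.
have hy : y - y' \in I by apply/quor_eqP; rewrite reprK.
have -> : x * y - x' * y' = (x - x') * y + x' * (y - y').
  by rewrite mulrBl mulrBr addrA subrK.
apply: rpredD; [exact: ideal_mulr | exact: ideal_mull].
Qed.

Lemma quor_pi_add (x y : R) :
  \pi_(quor I) (x + y) = \pi_(quor I) x + \pi_(quor I) y.
Proof. exact: (raddfD (\pi_(Quotient.quot I))). Qed.

Fact quor_mulA : associative quor_mul.
Proof.
elim/quotW=> x; elim/quotW=> y; elim/quotW=> z.
rewrite -(quor_pi_mul y z) -(quor_pi_mul x y).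
by rewrite -(quor_pi_mul x) -(quor_pi_mul _ z) mulrA.
Qed.

Fact quor_mul1r : left_id (\pi_(quor I) 1) quor_mul.
Proof. by elim/quotW=> x; rewrite -quor_pi_mul mul1r. Qed.

Fact quor_mulr1 : right_id (\pi_(quor I) 1) quor_mul.
Proof. by elim/quotW=> x; rewrite -quor_pi_mul mulr1. Qed.

Fact quor_mulDl : left_distributive quor_mul +%R.
Proof.
elim/quotW=> x; elim/quotW=> y; elim/quotW=> z.
rewrite -(quor_pi_mul x z) -(quor_pi_mul y z) -(quor_pi_add x y).
by rewrite -(quor_pi_mul _ z) -(quor_pi_add (x * z)) mulrDl.
Qed.

Fact quor_mulDr : right_distributive quor_mul +%R.
Proof.
elim/quotW=> x; elim/quotW=> y; elim/quotW=> z.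
rewrite -(quor_pi_mul x y) -(quor_pi_mul x z) -(quor_pi_add y z).
by rewrite -(quor_pi_mul x) -(quor_pi_add (x * y)) mulrDr.
Qed.

HB.instance Definition _ := GRing.Zmodule_isPzRing.Build (quor I)
  quor_mulA quor_mul1r quor_mulr1 quor_mulDl quor_mulDr.

End QuotientRing.

Inductive ideal_spec (R : nzRingType) (Y : R -> Prop) : R -> Prop :=
  | Ideal0 : ideal_spec Y 0
  | IdealGen y : Y y -> ideal_spec Y y
  | IdealB x y : ideal_spec Y x -> ideal_spec Y y -> ideal_spec Y (x - y)
  | IdealMl a x : ideal_spec Y x -> ideal_spec Y (a * x)
  | IdealMr x a : ideal_spec Y x -> ideal_spec Y (x * a).

Definition ideal_of (R : nzRingType) (Y : R -> Prop) : {pred R} :=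
  fun x => `[< ideal_spec Y x >].

Section IdealOf.
Variables (R : nzRingType) (Y : R -> Prop).

Lemma ideal_of_zmod_closed : zmod_closed (ideal_of Y).
Proof.
split=> [|x y /asboolP hx /asboolP hy]; apply/asboolP; first exact: Ideal0.
exact: IdealB.
Qed.

Lemma ideal_of_mull a x : x \in ideal_of Y -> a * x \in ideal_of Y.
Proof. by move=> /asboolP hx; apply/asboolP; exact: IdealMl. Qed.

Lemma ideal_of_mulr x a : x \in ideal_of Y -> x * a \in ideal_of Y.
Proof. by move=> /asboolP hx; apply/asboolP; exact: IdealMr. Qed.

HB.instance Definition _ :=
  GRing.isZmodClosed.Build R (ideal_of Y) ideal_of_zmod_closed.
HB.instance Definition _ :=
  isTwoSided.Build R (ideal_of Y) ideal_of_mull ideal_of_mulr.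

End IdealOf.

(* Left modules over S (x)_k S^op, written out as two commuting actions of S
   that restrict to the same action of k. *)
Record bimodule (k : fieldType) (S : algType k) := Bimodule {
  bm_car :> zmodType;
  bm_l : S -> bm_car -> bm_car;
  bm_r : bm_car -> S -> bm_car;
  bm_lDl : forall a b x, bm_l (a + b) x = bm_l a x + bm_l b x;
  bm_lDr : forall a x y, bm_l a (x + y) = bm_l a x + bm_l a y;
  bm_lM : forall a b x, bm_l (a * b) x = bm_l a (bm_l b x);
  bm_l1 : forall x, bm_l 1 x = x;
  bm_rDl : forall x y a, bm_r (x + y) a = bm_r x a + bm_r y a;
  bm_rDr : forall x a b, bm_r x (a + b) = bm_r x a + bm_r x b;
  bm_rM : forall x a b, bm_r x (a * b) = bm_r (bm_r x a) b;
  bm_r1 : forall x, bm_r x 1 = x;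
  bm_lr : forall a x b, bm_l a (bm_r x b) = bm_r (bm_l a x) b;
  bm_k : forall (c : k) x, bm_l c%:A x = bm_r x c%:A
}.

Definition bimod_hom (k : fieldType) (S : algType k) (M N : bimodule S)
    (f : M -> N) : Prop :=
  [/\ forall x y, f (x + y) = f x + f y,
      forall a x, f (bm_l a x) = bm_l a (f x)
    & forall x a, f (bm_r x a) = bm_r (f x) a].

Definition bimod_projective (k : fieldType) (S : algType k) (P : bimodule S) :=
  forall (M N : bimodule S) (g : M -> N) (f : P -> N),
    bimod_hom g -> (forall y, exists x, g x = y) -> bimod_hom f ->
    exists2 h : P -> M, bimod_hom h & forall x, g (h x) = f x.

Definition regular_bimod (k : fieldType) (S : algType k) : bimodule S :=
  @Bimodule k S S (fun a x => a * x) (fun x a => x * a)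
    (fun a b x => mulrDl a b x) (fun a x y => mulrDr a x y)
    (fun a b x => esym (mulrA a b x)) (fun x => mul1r x)
    (fun x y a => mulrDl x y a) (fun x a b => mulrDr x a b)
    (fun x a b => mulrA x a b) (fun x => mulr1 x)
    (fun a x b => mulrA a x b)
    (fun c x => etrans (mulr_algl c x) (esym (mulr_algr c x))).

Definition separable_alg (k : fieldType) (S : algType k) : Prop :=
  bimod_projective (regular_bimod S).

Section Tensor.
Variables (A : pzRingType) (N : zmodType) (act : N -> A -> N).

(* [N], with right action [act], tensored over [A] with the left module [M]. *)
Inductive tensor_rel (M : lmodType A) : {freeg (N * M)} -> Prop :=
  | TensorDl s s' x : tensor_rel (<<(s + s', x)>> - <<(s, x)>> - <<(s', x)>>)
  | TensorDr s x x' : tensor_rel (<<(s, x + x')>> - <<(s, x)>> - <<(s, x')>>)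
  | TensorA s a x : tensor_rel (<<(act s a, x)>> - <<(s, a *: x)>>).

Definition tensor (M : lmodType A) := Quotient.quot (subgroup_of (@tensor_rel M)).

HB.instance Definition _ (M : lmodType A) := GRing.Zmodule.on (tensor M).
HB.instance Definition _ (M : lmodType A) := Quotient.on (tensor M).

Definition tens (M : lmodType A) (s : N) (x : M) : tensor M :=
  \pi_(tensor M) <<(s, x)>>.

Definition tensor_map (M M' : lmodType A) (f : M -> M') (z : tensor M) :
    tensor M' :=
  \pi_(tensor M') (fglift (fun sx : N * M => <<(sx.1, f sx.2)>>) (repr z)).

End Tensor.

Arguments tens {A N} act {M} s x.
Arguments tensor_map {A N} act {M M'} f z.

Lemma tensor_map_pi (A : pzRingType) (N : zmodType) (act : N -> A -> N)
    (M M' : lmodType A) (f : {linear M -> M'}) (D : {freeg (N * M)}) :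
  tensor_map act f (\pi_(tensor act M) D) =
  \pi_(tensor act M') (fglift (fun sx : N * M => <<(sx.1, f sx.2)>>) D).
Proof.
set F := fun sx : N * M => <<(sx.1, f sx.2)>> : {freeg (N * M')}.
have FB : additive (fglift F) by exact: lift_is_additive.
have FU s x : fglift F <<(s, x)>> = <<(s, f x)>> by rewrite liftU scale1r.
have F0 : fglift F 0 = 0 by rewrite -(subrr 0) FB subrr.
apply/eqP; rewrite -[_ == _]Quotient.idealrBE -FB.
have: repr (\pi_(tensor act M) D) - D \in subgroup_of (@tensor_rel A N act M).
  by rewrite Quotient.idealrBE; apply/eqP; exact: reprK.
move: (_ - D) => {}D /asboolP; elim=> {D}.
- by rewrite F0 rpred0.
- move=> _ [s s' x|s x x'|s a x]; rewrite !FB !FU; apply/asboolP/SubgroupGen.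
  + exact: TensorDl.
  + rewrite raddfD; exact: TensorDr.
  + rewrite linearZZ; exact: TensorA.
- by move=> D E _ hD _ hE; rewrite FB rpredB.
Qed.

Record grmod (A : pzRingType) (grA : nat -> A -> Prop) := Grmod {
  gm_car :> lmodType A;
  gm_pc : nat -> gm_car -> Prop;
  gm_pcB : forall m x y, gm_pc m x -> gm_pc m y -> gm_pc m (x - y);
  gm_act : forall q m a x, grA q a -> gm_pc m x -> gm_pc (q + m)%N (a *: x);
  gm_dec : forall x, exists N f,
    (forall m, gm_pc m (f m)) /\ x = \sum_(m < N) f m;
  gm_uniq : forall N f, (forall m, gm_pc m (f m)) ->
    \sum_(m < N) f m = 0 -> forall m, (m < N)%N -> f m = 0
}.

Definition mod_projective (A : pzRingType) (P : lmodType A) : Prop :=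
  forall (M N : lmodType A) (g : {linear M -> N}) (f : {linear P -> N}),
    (forall y, exists x, g x = y) ->
    exists h : {linear P -> M}, forall x, g (h x) = f x.

(* [S] is an [A]-module, concentrated in degree 0, through [eps : A -> S]. *)
Record resolution (A : pzRingType) (grA : nat -> A -> Prop)
    (S : pzRingType) (eps : A -> S) := Resolution {
  res_mod : nat -> grmod grA;
  res_d : forall i, {linear res_mod i.+1 -> res_mod i};
  res_eps : {additive res_mod 0 -> S};
  res_projective : forall i, mod_projective (res_mod i);
  res_dgr : forall i m x, gm_pc m x -> gm_pc m (res_d i x);
  res_epsA : forall a x, res_eps (a *: x) = eps a * res_eps x;
  res_epsgr : forall m x, gm_pc m.+1 x -> res_eps x = 0;
  res_eps_surj : forall s, exists x, res_eps x = s;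
  res_exact0 : forall x, res_eps x = 0 <-> exists y, x = res_d 0 y;
  res_exact : forall i x, res_d i x = 0 <-> exists y, x = res_d i.+1 y
}.

Section Tor.
Variables (A : pzRingType) (grA : nat -> A -> Prop).
Variables (S : pzRingType) (eps : A -> S).

Let act (s : S) (a : A) := s * eps a.

Definition tensor_pc (M : grmod grA) (m : nat) : {pred tensor act M} :=
  subgroup_of (fun z => exists s x, gm_pc m x /\ z = tens act s x).
Arguments tensor_pc : clear implicits.

(* Tor^A_{i+1,m}(S, S) <> 0: the (i+1)-st homology of S (x)_A F has a nonzero
   element of degree m.  The homology does not depend on the resolution F. *)
Definition Tor_neq0 (i m : nat) : Prop :=
  exists (F : resolution grA eps) (z : tensor act (res_mod F i.+1)),
    [/\ z \in tensor_pc _ m,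
        tensor_map act (res_d F i) z = 0
      & ~ exists2 w, w \in tensor_pc _ m
                   & z = tensor_map act (res_d F i.+1) w].

End Tor.

Section PolynomialRing.
Variables (k : fieldType) (S : algType k) (n : nat).
Notation T := {mpoly S[n]}.
Implicit Types (x y t u : T) (P R : T -> Prop) (I : twoSidedIdeal T).

Definition pr (m : nat) : T -> T := pihomog mdeg m.

Definition Tpc (m : nat) : T -> Prop := fun x => x \is m.-homog.

Definition Tlt (m : nat) : T -> Prop :=
  fun x => forall mu, mu \in msupp x -> (mdeg mu < m)%N.

Definition Tle (m : nat) : T -> Prop :=
  fun x => forall mu, mu \in msupp x -> (mdeg mu <= m)%N.

Definition Tge (m : nat) : T -> Prop :=
  fun x => forall mu, mu \in msupp x -> (m <= mdeg mu)%N.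

Lemma Tlt0 m : Tlt m (0 : T).
Proof. by move=> mu; rewrite msupp0. Qed.

Lemma TltB m x y : Tlt m x -> Tlt m y -> Tlt m (x - y).
Proof. by move=> hx hy mu /msuppB_le; rewrite mem_cat => /orP[/hx|/hy]. Qed.

Lemma TltD m x y : Tlt m x -> Tlt m y -> Tlt m (x + y).
Proof. by move=> hx hy mu /msuppD_le; rewrite mem_cat => /orP[/hx|/hy]. Qed.

Lemma TltMl e d a x : Tpc d a -> Tlt e x -> Tlt (d + e) (a * x).
Proof.
move=> /dhomogP ha hx mu /msuppM_le /allpairsP[[m1 m2] /= [/ha <- /hx h ->]].
by rewrite mdegD ltn_add2l.
Qed.

Lemma TltMr e d a x : Tpc d a -> Tlt e x -> Tlt (e + d) (x * a).
Proof.
move=> /dhomogP ha hx mu /msuppM_le /allpairsP[[m1 m2] /= [/hx h /ha <- ->]].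
by rewrite mdegD ltn_add2r.
Qed.

Lemma pr_sum m N (F : 'I_N -> T) : pr m (\sum_i F i) = \sum_i pr m (F i).
Proof. exact: raddf_sum. Qed.

Lemma prM d e m a x :
  pr m (pr d a * pr e x) = if d + e == m then pr d a * pr e x else 0.
Proof.
have h : pr d a * pr e x \is (d + e)%N.-homog by apply: dhomogM; exact: pihomogP.
case: eqP => [<-|/eqP ne]; first by rewrite /pr pihomog_dE.
by rewrite [LHS](pihomog_ne0 _ h) // eq_sym.
Qed.

Lemma sum_pr x : x = \sum_(d < msize x) pr d x.
Proof. exact: pihomog_partitionE. Qed.

Lemma Tlt_pr d m x : (d < m)%N -> Tlt m (pr d x).
Proof. by move=> hd mu; move/dhomogP: (pihomogP mdeg d x) => h /h ->. Qed.

Lemma pr_top m x : Tle m x -> Tlt m (pr m x - x).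
Proof.
move=> hx; have hs : (msize x <= m.+1)%N.
  rewrite mmeasureE; apply/bigmax_leqP_seq => mu hmu _; exact: hx.
rewrite {2}(pihomog_partitionE hs) big_ord_recr /= opprD addrCA subrr addr0.
rewrite -sub0r; apply: TltB; first exact: Tlt0.
elim/big_ind: _ => [|u v|i _]; [exact: Tlt0 | exact: TltD |].
exact: Tlt_pr.
Qed.

Definition subbimod P : Prop :=
  [/\ P 0, forall x y, P x -> P y -> P (x - y),
      forall (s : S) x, P x -> P (s%:MP * x)
    & forall (s : S) x, P x -> P (x * s%:MP)].

Definition graded (Y : T -> Prop) : Prop := forall x, Y x -> forall m, Y (pr m x).

Definition decomposables I : {pred T} :=
  subgroup_of (fun x => exists t y, [/\ Tpc 1 t, y \in I & x = t * y \/ x = y * t]).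

Definition bimod_of_relations I R : Prop :=
  [/\ subbimod R, graded R, forall x, R x -> x \in I,
      forall x, R x -> x \in decomposables I -> x = 0
    & forall x, x \in I -> exists r y,
        [/\ R r, y \in decomposables I & x = r + y]].

Definition Rof P : T -> Prop :=
  fun x => forall m, exists y, [/\ P y, Tle m y & pr m x = pr m y].

Definition U P := quor (ideal_of P).

Definition Ule P (m : nat) : {pred U P} :=
  fun a => `[< exists2 t, Tle m t & a = \pi_(U P) t >].
Arguments Ule : clear implicits.

(* [Ult P m] is U(P)^{<= m-1}, with U(P)^{<= -1} = 0. *)
Definition Ult P (m : nat) : {pred U P} :=
  fun a => `[< exists2 t, Tlt m t & a = \pi_(U P) t >].
Arguments Ult : clear implicits.

Lemma Ult_zmod_closed P m : zmod_closed (Ult P m).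
Proof.
split=> [|_ _ /asboolP[x hx ->] /asboolP[y hy ->]]; apply/asboolP.
  by exists 0; [exact: Tlt0 | rewrite /U; exact/esym/raddf0].
exists (x - y); first exact: TltB.
exact/esym/(raddfB (\pi_(Quotient.quot (ideal_of P)))).
Qed.

HB.instance Definition _ P m :=
  GRing.isZmodClosed.Build (U P) (Ult P m) (Ult_zmod_closed P m).

Definition Uquo P (m : nat) := Quotient.quot (Ult P m).

(* gr U(P), the direct sum of the U(P)^{<= m} / U(P)^{<= m-1}, as a set of
   families. *)
Definition in_grU P (f : forall m, Uquo P m) : Prop :=
  (forall m, exists2 a, a \in Ule P m & f m = \pi_(Uquo P m) a) /\
  (exists N, forall m, (N <= m)%N -> f m = 0).

(* The class of x goes to the family of the classes of its components p^m(x),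
   whatever the representative x, by [PhiE]. *)
Definition Phi P (q : quor (ideal_of (Rof P))) : forall m, Uquo P m :=
  fun m => \pi_(Uquo P m) (\pi_(U P) (pr m (repr q))).

Lemma ideal_Rof P y m :
  ideal_spec (Rof P) y -> exists2 z, ideal_spec P z & Tlt m (pr m y - z).
Proof.
move=> hy.
have Q0 j : exists2 z, ideal_spec P z & Tlt j (0 - z).
  by exists 0; [exact: Ideal0 | rewrite subr0; exact: Tlt0].
have idN z : ideal_spec P z -> ideal_spec P (- z).
  by move=> h; rewrite -sub0r; apply: IdealB => //; exact: Ideal0.
have QD j u v : (exists2 z, ideal_spec P z & Tlt j (u - z)) ->
    (exists2 z, ideal_spec P z & Tlt j (v - z)) ->
    exists2 z, ideal_spec P z & Tlt j (u + v - z).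
  case=> z hz huz [z' hz' hvz]; exists (z - - z'); first exact/IdealB/idN.
  by rewrite opprK opprD addrACA; exact: TltD.
elim: hy m => [m|{}y hy m|u v _ hu _ hv m|a u _ hu m|u a _ hu m].
- by rewrite /pr pihomog0.
- have [z [Pz lez ->]] := hy m; exists z; first exact: IdealGen.
  exact: pr_top.
- have [z hz ltz] := hu m; have [z' hz' ltz'] := hv m.
  exists (z - z'); first exact: IdealB.
  have -> : pr m (u - v) - (z - z') = (pr m u - z) - (pr m v - z').
    by rewrite /pr pihomogB !opprD !opprK addrACA.
  exact: TltB.
- rewrite (sum_pr a) {1}(sum_pr u) mulr_suml pr_sum.
  elim/big_ind: _ => [||i _]; [exact: Q0 | exact: QD |].
  rewrite mulr_sumr pr_sum.
  elim/big_ind: _ => [||j _]; [exact: Q0 | exact: QD |].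
  rewrite prM; case: eqP => [<-|_]; last exact: Q0.
  have [z hz ltz] := hu j; exists (pr i a * z); first exact: IdealMl.
  by rewrite -mulrBr; apply: TltMl => //; exact: pihomogP.
- rewrite {1}(sum_pr u) (sum_pr a) mulr_suml pr_sum.
  elim/big_ind: _ => [||i _]; [exact: Q0 | exact: QD |].
  rewrite mulr_sumr pr_sum.
  elim/big_ind: _ => [||j _]; [exact: Q0 | exact: QD |].
  rewrite prM; case: eqP => [<-|_]; last exact: Q0.
  have [z hz ltz] := hu i; exists (z * pr j a); first exact: IdealMr.
  by rewrite -mulrBl; apply: TltMr => //; exact: pihomogP.
Qed.

Lemma PhiE P x m :
  @Phi P (\pi_(quor (ideal_of (Rof P))) x) m =
  \pi_(Uquo P m) (\pi_(U P) (pr m x)).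
Proof.
rewrite /Phi; set r := repr _.
have /asboolP/(ideal_Rof m)[z hz ltz] : r - x \in ideal_of (Rof P).
  by apply/quor_eqP; rewrite reprK.
apply/eqP; rewrite -[_ == _]Quotient.idealrBE; apply/asboolP.
exists (pr m (r - x) - z) => //.
rewrite -[LHS](raddfB (\pi_(Quotient.quot (ideal_of P)))) /pr -pihomogB.
apply/quor_eqP; rewrite opprB addrC subrK; exact/asboolP.
Qed.

(* Phi is a morphism of graded rings into gr U(P), hence an isomorphism if and
   only if it is bijective. *)
Definition PBW_type P : Prop :=
  (forall q q', (forall m, @Phi P q m = @Phi P q' m) -> q = q') /\
  (forall f, in_grU f -> exists q, forall m, @Phi P q m = f m).

Definition Pfil P (m : nat) : {pred T} :=
  subgroup_of (fun x => exists i j l t p u, [/\ (i + j + l)%N = m,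
    Tle i t, P p /\ Tle j p, Tle l u & x = t * p * u]).

Definition jacobi P (m : nat) : Prop :=
  forall x, x \in Pfil P m.+1 -> Tle m x -> x \in Pfil P m.

Definition quo_pc I (m : nat) : quor I -> Prop :=
  fun a => exists2 t, Tpc m t & a = \pi_(quor I) t.

(* The projection of A onto A^0 = S, well defined if I is contained in
   T^{>= 1}. *)
Definition aug I (a : quor I) : S := (repr a)@_0%MM.

Lemma aug_pi I t :
  (forall x, x \in I -> x@_0%MM = 0) -> aug (\pi_(quor I) t) = t@_0%MM.
Proof.
move=> hI; apply/eqP; rewrite -subr_eq0 /aug -mcoeffB; apply/eqP/hI.
by apply/quor_eqP; rewrite reprK.
Qed.

Definition Tor3_neq0 I (m : nat) : Prop := Tor_neq0 (@quo_pc I) (@aug I) 2 m.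

(* c(A), with [None] for infinity. *)
Definition complexity I : option int :=
  match pselect (exists m, `[< Tor3_neq0 I m >]),
        pselect (exists N, forall m, `[< Tor3_neq0 I m >] -> (m <= N)%N) with
  | left ex, left ub => Some ((ex_maxn ex (projT2 (cid ub)))%:Z - 1)
  | left _, right _ => None
  | right _, _ => Some (-1)
  end.

Definition le_ext (m : nat) (c : option int) : Prop :=
  if c is Some z then (m%:Z <= z)%R else True.

End PolynomialRing.

(* Main.v *)
Require Import Defs.
From HB Require Import structures.
From mathcomp Require Import all_boot all_order all_algebra.
From mathcomp Require Import freeg mpoly.
From mathcomp Require Import boolp zify.
Set Implicit Arguments.
Unset Strict Implicit.
Unset Printing Implicit Defensive.
Import GRing.Theory.
Local Open Scope ring_scope.
Local Open Scope quotient_scope.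

(* Since R lies in degrees >= 2, the filtration has P_0 = P_1 = 0; a descent on
   degrees then shows that P is of PBW-type if and only if (J_m) holds for every
   m >= 1.  So it suffices to prove (J_m) from the (J_j) with j < m when
   Tor_{3,m+1}(S, S) = 0.

   Take the free graded resolution of S over A that starts with A, A^n and the
   free module F2 on all triples (d, t, q), where t in (T^d)^n and q in P_{d+1}
   has leading form sum_i t_i X_i.  Let Omega be the kernel of F2 -> A^n.  The
   vanishing of Tor_{3,m+1} says that, in degree m + 1, every element of Omega
   with coefficients in A^+ lies in A^+ Omega.

   An element x of P_{m+1} of degree <= m is, modulo P_m, of the form
   sum_i w_i X_i with w_i in P_m: the R-component of its vanishing leading form
   is decomposable, hence zero.  The leading forms f_i of the w_i satisfy
   sum_i f_i X_i = 0, so by exactness of the Koszul complex they come from a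
   combination of triples with q = 0, which is an element of Omega.  Writing it
   as a sum of a * omega with a in A^+ and omega in Omega of smaller degree, the
   relation lifted from omega drops in degree and is controlled by some (J_j),
   j < m. *)

(** * Free modules *)

Section FreeModule.
Variables (A : pzRingType) (B : choiceType).

(** The basis [B] may be infinite, as for the module on all syzygies below. Functions with finite
    support make coefficients readable by application and equality pointwise. *)
Definition finite_support (f : B -> A) : bool :=
  `[< exists s : seq B, forall b, b \notin s -> f b = 0 >].

Record fmod := Fmod { fval :> B -> A; fvalP : finite_support fval }.

HB.instance Definition _ := [isSub for fval].
HB.instance Definition _ := gen_eqMixin fmod.
HB.instance Definition _ := gen_choiceMixin fmod.

Implicit Types f g : fmod.

Lemma fmodP f g : (forall b, f b = g b) -> f = g.
Proof. by move=> h; apply: val_inj; apply: funext. Qed.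

Fact fmod0_proof : finite_support (fun=> 0).
Proof. by apply/asboolP; exists [::]. Qed.

Fact fmodN_proof f : finite_support (fun b => - f b).
Proof.
by apply/asboolP; case/asboolP: (fvalP f) => s hs; exists s => b /hs ->;
  rewrite oppr0.
Qed.

Fact fmodD_proof f g : finite_support (fun b => f b + g b).
Proof.
apply/asboolP; case/asboolP: (fvalP f) => s hs; case/asboolP: (fvalP g) => t ht.
exists (s ++ t) => b; rewrite mem_cat negb_or => /andP[/hs -> /ht ->].
by rewrite addr0.
Qed.

Fact fmodZ_proof a f : finite_support (fun b => a * f b).
Proof.
by apply/asboolP; case/asboolP: (fvalP f) => s hs; exists s => b /hs ->;
  rewrite mulr0.
Qed.

Fact fmodU_proof a b : finite_support (fun c => if c == b then a else 0).
Proof.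
by apply/asboolP; exists [:: b] => c; rewrite inE => /negbTE ->.
Qed.

Definition fmod0 := Fmod fmod0_proof.
Definition fmodN f := Fmod (fmodN_proof f).
Definition fmodD f g := Fmod (fmodD_proof f g).
Definition fmodZ a f := Fmod (fmodZ_proof a f).
Definition fmodU a b := Fmod (fmodU_proof a b).

Fact fmodDA : associative fmodD.
Proof. by move=> f g h; apply: fmodP => b /=; rewrite addrA. Qed.
Fact fmodDC : commutative fmodD.
Proof. by move=> f g; apply: fmodP => b /=; rewrite addrC. Qed.
Fact fmod0D : left_id fmod0 fmodD.
Proof. by move=> f; apply: fmodP => b /=; rewrite add0r. Qed.
Fact fmodND : left_inverse fmod0 fmodN fmodD.
Proof. by move=> f; apply: fmodP => b /=; rewrite addNr. Qed.

HB.instance Definition _ :=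
  GRing.isZmodule.Build fmod fmodDA fmodDC fmod0D fmodND.

Fact fmodZA a c f : fmodZ a (fmodZ c f) = fmodZ (a * c) f.
Proof. by apply: fmodP => b /=; rewrite mulrA. Qed.
Fact fmod1Z : left_id 1 fmodZ.
Proof. by move=> f; apply: fmodP => b /=; rewrite mul1r. Qed.
Fact fmodZDr : right_distributive fmodZ +%R.
Proof. by move=> a f g; apply: fmodP => b /=; rewrite mulrDr. Qed.
Fact fmodZDl f : {morph fmodZ^~ f : a c / a + c}.
Proof. by move=> a c; apply: fmodP => b /=; rewrite mulrDl. Qed.

HB.instance Definition _ :=
  GRing.Zmodule_isLmodule.Build A fmod fmodZA fmod1Z fmodZDr fmodZDl.

Lemma fmodDE f g b : (f + g) b = f b + g b. Proof. by []. Qed.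
Lemma fmodBE f g b : (f - g) b = f b - g b. Proof. by []. Qed.
Lemma fmodZE a f b : (a *: f) b = a * f b. Proof. by []. Qed.
Lemma fmodUE a b c : fmodU a b c = if c == b then a else 0. Proof. by []. Qed.

Lemma fmod_sumE I (r : seq I) (P : pred I) (F : I -> fmod) b :
  (\sum_(i <- r | P i) F i) b = \sum_(i <- r | P i) F i b.
Proof. by elim/big_rec2: _ => // i x y _ <-. Qed.

Lemma fmodUZ a b : fmodU a b = a *: fmodU 1 b.
Proof.
by apply: fmodP => c; rewrite fmodZE !fmodUE; case: eqP; rewrite ?mulr1 ?mulr0.
Qed.

(** A chosen list that contains the support; [f] may vanish at some of its entries. *)
Definition fsupp f : seq B := undup (projT1 (cid (asboolW (fvalP f)))).

Lemma fsupp_uniq f : uniq (fsupp f). Proof. exact: undup_uniq. Qed.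

Lemma fsuppN f b : b \notin fsupp f -> f b = 0.
Proof. by rewrite mem_undup; case: cid => s hs /=; apply: hs. Qed.

(** Terms with zero coefficient contribute nothing, and the remaining entries of the two lists form
    the same set, so the lists agree up to permutation. *)
Lemma fmod_supp_sum (V : zmodType) (F : B -> A -> V) f (s : seq B) :
  (forall b, F b 0 = 0) -> uniq s -> (forall b, b \notin s -> f b = 0) ->
  \sum_(b <- fsupp f) F b (f b) = \sum_(b <- s) F b (f b).
Proof.
move=> F0 us hs; have key (t : seq B) :
   \sum_(b <- t) F b (f b) = \sum_(b <- [seq b <- t | f b != 0]) F b (f b).
  rewrite big_filter [RHS]big_mkcond /=; apply: eq_bigr => b _.
  by case: eqP => // ->.
rewrite (key s) (key (fsupp f)); apply: perm_big.
apply: uniq_perm; rewrite ?filter_uniq ?fsupp_uniq // => b.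
rewrite !mem_filter; case: eqP => //= nz; apply/idP/idP => _.
  by apply/negPn/negP => /hs.
by apply/negPn/negP => /fsuppN.
Qed.

Lemma fmod_expand f : f = \sum_(b <- fsupp f) f b *: fmodU 1 b.
Proof.
apply: fmodP => c; rewrite fmod_sumE.
have [hc|hc] := boolP (c \in fsupp f); last first.
  rewrite (fsuppN hc) big1_seq // => b /andP[_ hb]; rewrite fmodZE fmodUE.
  by case: eqP => [e|]; rewrite ?mulr0 //; rewrite e hb in hc.
rewrite (bigD1_seq c) ?fsupp_uniq // fmodZE fmodUE eqxx mulr1 big1 =>
  [|b /negbTE].
  by rewrite /= addr0.
by rewrite fmodZE fmodUE eq_sym => ->; rewrite mulr0.
Qed.

Section Extension.
Variables (M : lmodType A) (g : B -> M).

Definition fext f : M := \sum_(b <- fsupp f) f b *: g b.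

Lemma fextE f s : uniq s -> (forall b, b \notin s -> f b = 0) ->
  fext f = \sum_(b <- s) f b *: g b.
Proof.
by apply: (fmod_supp_sum (F := fun b a => a *: g b)) => b; rewrite scale0r.
Qed.

Fact fext_is_linear : linear fext.
Proof.
(* [fsupp] of the combination need not be related to those of [f] and [h], so all three sums are
   taken over one list. *)
move=> a f h; set s := undup (fsupp f ++ fsupp h).
have us : uniq s by exact: undup_uniq.
have hf b : b \notin s -> f b = 0.
  by rewrite mem_undup mem_cat negb_or => /andP[/fsuppN].
have hh b : b \notin s -> h b = 0.
  by rewrite mem_undup mem_cat negb_or => /andP[_ /fsuppN].
rewrite (fextE us hf) (fextE us hh) (@fextE _ s) //.
  rewrite scaler_sumr -big_split /=; apply: eq_bigr => b _.
  by rewrite scalerDl scalerA.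
by move=> b nb; rewrite fmodDE fmodZE hf // hh // mulr0 addr0.
Qed.

HB.instance Definition _ :=
  GRing.isLinear.Build A fmod M *:%R fext fext_is_linear.

Lemma fextU a b : fext (fmodU a b) = a *: g b.
Proof.
rewrite (@fextE _ [:: b]) // ?big_seq1 ?fmodUE ?eqxx // => c.
by rewrite inE => /negbTE; rewrite fmodUE => ->.
Qed.

End Extension.

Lemma fmod_linear_eq (M : lmodType A) (u v : {linear fmod -> M}) :
  (forall b, u (fmodU 1 b) = v (fmodU 1 b)) -> forall f, u f = v f.
Proof.
move=> h f; rewrite (fmod_expand f) !linear_sum; apply: eq_bigr => b _.
by rewrite !linearZZ h.
Qed.

(** A preimage is chosen for the image of each basis element and extended linearly. *)
Lemma fmod_projective : mod_projective fmod.
Proof.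
move=> M N g f gsurj.
pose h := fext (fun b => projT1 (cid (gsurj (f (fmodU 1 b))))).
exists h; apply: (fmod_linear_eq (u := g \o h)) => b /=.
by rewrite /h fextU scale1r; case: cid.
Qed.

End FreeModule.

(** * Graded rings with their projections, and graded free modules *)

Record grading (A : pzRingType) (grA : nat -> A -> Prop) := Grading {
  grpr : nat -> A -> A;
  grprB : forall d x y, grpr d (x - y) = grpr d x - grpr d y;
  grprP : forall d x, grA d (grpr d x);
  grprE : forall d e x, grA d x -> grpr e x = if d == e then x else 0;
  grpr_dec : forall x, exists N, forall M, (N <= M)%N ->
    x = \sum_(d < M) grpr d x;
  grA0 : forall d, grA d 0;
  grA1 : grA 0%N 1;
  grAB : forall d x y, grA d x -> grA d y -> grA d (x - y);
  grAM : forall d e x y, grA d x -> grA e y -> grA (d + e)%N (x * y)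
}.

Section GradedFree.
Variables (A : pzRingType) (grA : nat -> A -> Prop) (G : grading grA).

Lemma grpr0 d : grpr G d 0 = 0.
Proof. by rewrite -(subrr (0 : A)) grprB !subrr. Qed.

Lemma grprD d x y : grpr G d (x + y) = grpr G d x + grpr G d y.
Proof. by rewrite -{1}[y]opprK -[- y]sub0r !grprB grpr0 sub0r opprK. Qed.

(* Degree m part of A(-d). *)
Definition shift_pc (d m : nat) (a : A) : Prop :=
  if (d <= m)%N then grA (m - d) a else a = 0.

Definition shift_pr (d m : nat) (a : A) : A :=
  if (d <= m)%N then grpr G (m - d) a else 0.

Lemma shift_pc0 d m : shift_pc d m 0.
Proof. by rewrite /shift_pc; case: ifP => // _; exact: (grA0 G). Qed.

Lemma shift_pcB d m x y : shift_pc d m x -> shift_pc d m y ->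
  shift_pc d m (x - y).
Proof.
rewrite /shift_pc; case: ifP => _; first exact: (grAB G).
by move=> -> ->; rewrite subr0.
Qed.

Lemma shift_pcD d m x y : shift_pc d m x -> shift_pc d m y ->
  shift_pc d m (x + y).
Proof.
move=> hx hy; rewrite -[y]opprK -[- y]sub0r; apply: shift_pcB => //.
by apply: shift_pcB => //; exact: shift_pc0.
Qed.

Lemma shift_pcM d m q a x : grA q a -> shift_pc d m x ->
  shift_pc d (q + m) (a * x).
Proof.
rewrite /shift_pc => ha; case: (leqP d m) => h.
  rewrite (leq_trans h (leq_addl _ _)) -addnBA //; exact: (grAM G).
by move=> ->; rewrite mulr0; exact: shift_pc0.
Qed.

Lemma shift_prP d m x : shift_pc d m (shift_pr d m x).
Proof. by rewrite /shift_pc /shift_pr; case: (leqP d m) => // _;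
  exact: grprP. Qed.

Lemma shift_pr0 d m : shift_pr d m 0 = 0.
Proof. by rewrite /shift_pr grpr0 if_same. Qed.

Lemma shift_prD d m x y : shift_pr d m (x + y) = shift_pr d m x + shift_pr d m
  y.
Proof. by rewrite /shift_pr; case: ifP; rewrite ?grprD ?addr0. Qed.

Lemma shift_pr_sum d m I (r : seq I) (P : pred I) (F : I -> A) :
  shift_pr d m (\sum_(i <- r | P i) F i) = \sum_(i <- r |
    P i) shift_pr d m (F i).
Proof. by apply: big_morph; [exact: shift_prD | exact: shift_pr0]. Qed.

Lemma shift_prE d m m' x : shift_pc d m x ->
  shift_pr d m' x = if m == m' then x else 0.
Proof.
rewrite /shift_pc /shift_pr; case: (leqP d m) => h; last first.
  by move=> ->; rewrite grpr0 !if_same.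
move=> hx; case: (leqP d m') => h'.
  by rewrite (grprE G _ hx) -(eqn_add2r d) !subnK.
by case: eqP => // e; move: h h'; rewrite e => h; rewrite ltnNge h.
Qed.

(** Stated for every large [M], so that the maximum of the bounds of finitely many coefficients
    serves them all in [fmod_pr_dec]. *)
Lemma shift_pr_dec d x : exists N, forall M, (N <= M)%N ->
  x = \sum_(m < M) shift_pr d m x.
Proof.
have [N hN] := grpr_dec G x; exists (d + N)%N => M hM.
have [M' hM' ->] : exists2 M', (N <= M')%N & M = (d + M')%N.
  by exists (M - d)%N; rewrite ?subnKC ?leq_subRL // (leq_trans (leq_addr N d)
    hM).
rewrite big_split_ord big1 => [|i _];
  last by rewrite /shift_pr leqNgt /= ltn_ord.
rewrite /= add0r {1}(hN _ hM'); apply: eq_bigr => i _.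
by rewrite /shift_pr /= leq_addr addKn.
Qed.

Variables (B : choiceType) (deg : B -> nat).
Notation F := (fmod A B).

Definition fmod_pc (m : nat) (f : F) : Prop := forall b,
  shift_pc (deg b) m (f b).

Fact fmod_pr_proof m (f : F) : finite_support (fun b =>
  shift_pr (deg b) m (f b)).
Proof.
apply/asboolP; case/asboolP: (fvalP f) => s hs; exists s => b /hs ->.
exact: shift_pr0.
Qed.

Definition fmod_pr m f : F := Fmod (fmod_pr_proof m f).

Fact fmod_pcB m x y : fmod_pc m x -> fmod_pc m y -> fmod_pc m (x - y).
Proof. by move=> hx hy b; rewrite fmodBE; exact: shift_pcB. Qed.

Fact fmod_pc_act q m a x : grA q a -> fmod_pc m x -> fmod_pc (q + m) (a *: x).
Proof. by move=> ha hx b; rewrite fmodZE; exact: shift_pcM. Qed.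

Lemma fmod_pr_dec x : exists N, x = \sum_(m < N) fmod_pr m x.
Proof.
have [N hN] : exists N, forall b, b \in fsupp x ->
  x b = \sum_(m < N) shift_pr (deg b) m (x b).
  elim: (fsupp x) => [|b s [N hN]]; first by exists 0.
  pose K c := projT1 (cid (shift_pr_dec (deg c) (x c))).
  have hK c M : (K c <= M)%N -> x c = \sum_(m < M) shift_pr (deg c) m (x c).
    by rewrite /K; case: cid => K' /= h /h.
  exists (\max_(c <- b :: s) K c)%N => c hc; apply: hK; exact: leq_bigmax_seq.
exists N; apply: fmodP => b; rewrite fmod_sumE /=.
have [/hN //|/fsuppN ->] := boolP (b \in fsupp x).
by rewrite big1 // => i _; exact: shift_pr0.
Qed.

Lemma fmod_prE m m' x : fmod_pc m x -> fmod_pr m' x = if m == m' then x else 0.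
Proof.
move=> hx; apply: fmodP => b /=; rewrite (shift_prE _ (hx b)).
by case: ifP.
Qed.

Lemma fmod_prP m x : fmod_pc m (fmod_pr m x).
Proof. by move=> b; exact: shift_prP. Qed.

Fact fmod_pc_dec x : exists N f, (forall m,
  fmod_pc m (f m)) /\ x = \sum_(m < N) f m.
Proof.
have [N hN] := fmod_pr_dec x; exists N, (fmod_pr^~ x); split=> // m;
  exact: fmod_prP.
Qed.

Fact fmod_pc_uniq N (f : nat -> F) : (forall m, fmod_pc m (f m)) ->
  \sum_(m < N) f m = 0 -> forall m, (m < N)%N -> f m = 0.
Proof.
move=> hf e m hm; apply: fmodP => b.
have := congr1 (fun x : F => shift_pr (deg b) m (x b)) e.
rewrite fmod_sumE shift_pr_sum shift_pr0 (bigD1 (Ordinal hm)) //= big1 =>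
  [|i ne].
  by rewrite (shift_prE _ (hf m b)) eqxx addr0.
rewrite (shift_prE _ (hf i b)); case: eqP => // ei; case/eqP: ne;
  exact: val_inj.
Qed.

Definition fmod_grmod : grmod grA :=
  Grmod fmod_pcB fmod_pc_act fmod_pc_dec fmod_pc_uniq.

End GradedFree.

(** * Graded resolutions and the vanishing of Tor *)

Section GradedModules.
Variables (A : pzRingType) (grA : nat -> A -> Prop) (G : grading grA).

Lemma gm_pc0 (M : grmod grA) m : gm_pc m (0 : M).
Proof.
have [N [f [hf _]]] := gm_dec (0 : M).
by rewrite -(subrr (f m)); apply: gm_pcB.
Qed.

Lemma gm_pcD (M : grmod grA) m (x y : M) :
  gm_pc m x -> gm_pc m y -> gm_pc m (x + y).
Proof.
move=> hx hy; rewrite -[y]opprK -[- y]sub0r; apply: gm_pcB => //.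
by apply: gm_pcB => //; exact: gm_pc0.
Qed.

(** As [d] preserves degrees, the images of the components of [x] are the components of [d x = 0],
    so each of them vanishes; the preimages of the components are then added. *)
Lemma hom_exact (M1 M2 M3 : grmod grA) (d : {linear M2 -> M3})
    (d' : {linear M1 -> M2}) :
  (forall m x, gm_pc m x -> gm_pc m (d x)) ->
  (forall m x, gm_pc m x -> d x = 0 -> exists y, x = d' y) ->
  forall x, d x = 0 -> exists y, x = d' y.
Proof.
move=> hd hex x; have [N [f [hf ->]]] := gm_dec x.
rewrite linear_sum => /(gm_uniq (fun m => hd m _ (hf m))) h.
have {}h (i : 'I_N) : exists y, f i = d' y by apply: hex (hf i) (h i _).
exists (\sum_(i < N) projT1 (cid (h i))); rewrite linear_sum.
by apply: eq_bigr => i _; case: cid.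
Qed.

Lemma fext_graded (B : choiceType) (deg : B -> nat) (M : grmod grA)
    (g : B -> M) :
  (forall b, gm_pc (deg b) (g b)) ->
  forall m (x : fmod A B), fmod_pc grA deg m x -> gm_pc m (fext g x).
Proof.
move=> hg m x hx; rewrite /fext; elim/big_ind: _ => [|u v|b _].
- exact: gm_pc0.
- exact: gm_pcD.
- move: (hx b); rewrite /shift_pc; case: leqP => h hb;
  last by rewrite hb scale0r; exact: gm_pc0.
  by rewrite -(subnK h); apply: gm_act.
Qed.

Lemma fmod_pcU (B : choiceType) (deg : B -> nat) b d a : grA d a ->
  fmod_pc grA deg (d + deg b) (fmodU a b).
Proof.
move=> ha c; rewrite fmodUE; case: eqP => [->|_]; last exact: (shift_pc0 G).
by rewrite /shift_pc leq_addl addnK.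
Qed.

Section Cover.
Variables (M N : grmod grA) (d : {linear M -> N}).
Hypothesis hd : forall m x, gm_pc m x -> gm_pc m (d x).

(** All homogeneous elements of the kernel, with their degree, serve as a basis of the next free
    module; no generating set has to be selected. *)
Definition ker_gen : Type := {mx : nat * M | gm_pc mx.1 mx.2 /\ d mx.2 = 0}.
Definition ker_ix : choiceType := {classic ker_gen}.
Definition ker_deg (b : ker_ix) : nat := (sval (b : ker_gen)).1.
Definition ker_elt (b : ker_ix) : M := (sval (b : ker_gen)).2.

Definition cover : grmod grA := fmod_grmod G ker_deg.
Definition cover_map : {linear cover -> M} := fext ker_elt.

Lemma cover_graded m x : gm_pc m x -> gm_pc m (cover_map x).
Proof. by apply: fext_graded => b; case: (svalP (b : ker_gen)). Qed.

Lemma cover_map0 y : d (cover_map y) = 0.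
Proof.
rewrite /= /fext linear_sum big1 // => b _; rewrite linearZZ.
by case: (svalP (b : ker_gen)) => _ ->; rewrite scaler0.
Qed.

(** A homogeneous element of the kernel is itself one of the generators. The preimage has the same
    degree, which the graded form of Tor requires. *)
Lemma cover_hom m x : gm_pc m x -> d x = 0 ->
  exists2 y, gm_pc m y & x = cover_map y.
Proof.
move=> hx dx; have h : gm_pc (m, x).1 (m, x).2 /\ d (m, x).2 = 0 by [].
pose b : ker_ix := exist (fun mx =>
  gm_pc mx.1 mx.2 /\ d mx.2 = 0) _ h : ker_gen.
exists (fmodU 1 b); first exact: (fmod_pcU ker_deg b (grA1 G)).
by rewrite /= fextU scale1r.
Qed.

Lemma cover_exact x : d x = 0 <-> exists y, x = cover_map y.
Proof.
split=> [|[y ->]]; last exact: cover_map0.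
apply: hom_exact => // m {}x hx dx.
by have [y _ ->] := cover_hom hx dx; exists y.
Qed.

End Cover.

(** One differential with its source and target. The target of [next_stage s] is by conversion the
    source of [s], so iterating it makes consecutive differentials composable. *)
Record stage := Stage {
  st_src : grmod grA;
  st_tgt : grmod grA;
  st_d : {linear st_src -> st_tgt};
  st_gr : forall m x, gm_pc m x -> gm_pc m (st_d x);
  st_proj : mod_projective st_src
}.

Definition next_stage (s : stage) : stage :=
  @Stage (cover (st_d s)) (st_src s) (cover_map (st_d s))
    (cover_graded (d := st_d s)) (@fmod_projective A _).

Section BuildResolution.
Variables (S : pzRingType) (eps : A -> S) (F0 : grmod grA) (stage0 : stage).
Variables (d0 : {linear st_tgt stage0 -> F0}) (e : {additive F0 -> S}).
Hypothesis F0_proj : mod_projective F0.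
Hypothesis F1_proj : mod_projective (st_tgt stage0).
Hypothesis d0_gr : forall m x, gm_pc m x -> gm_pc m (d0 x).
Hypothesis eA : forall a x, e (a *: x) = eps a * e x.
Hypothesis e_gr : forall m x, gm_pc m.+1 x -> e x = 0.
Hypothesis e_surj : forall s, exists x, e x = s.
Hypothesis e_exact : forall x, e x = 0 <-> exists y, x = d0 y.
Hypothesis d0_exact : forall x, d0 x = 0 <-> exists y, x = st_d stage0 y.

Definition stages (i : nat) : stage := iter i next_stage stage0.

Definition res_term (i : nat) : grmod grA :=
  if i is j.+1 then st_tgt (stages j) else F0.

Definition res_diff (i : nat) : {linear res_term i.+1 -> res_term i} :=
  match i return {linear res_term i.+1 -> res_term i} with
  | 0 => d0
  | j.+1 => st_d (stages j)
  end.

Lemma res_term_proj i : mod_projective (res_term i).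
Proof.
case: i => [|[|i]]; [exact: F0_proj | exact: F1_proj |].
change (mod_projective (st_src (stages i))); exact: st_proj.
Qed.

Lemma res_diff_gr i m x : gm_pc m x -> gm_pc m (res_diff i x).
Proof. by case: i x => [|i] x; [exact: d0_gr | exact: st_gr]. Qed.

Lemma res_diff_exact i x : res_diff i x = 0 <-> exists y, x = res_diff i.+1 y.
Proof.
case: i x => [|i] x; first exact: d0_exact.
exact: (cover_exact (@st_gr (stages i))).
Qed.

Definition build_resolution : resolution grA eps :=
  @Resolution A grA S eps res_term res_diff e res_term_proj res_diff_gr eA e_gr
    e_surj e_exact res_diff_exact.

End BuildResolution.

End GradedModules.

(** * Tensoring with S, and boundaries modulo the augmentation ideal *)

Section TensorVanishing.
Variables (A : pzRingType) (grA : nat -> A -> Prop).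
Variables (S : pzRingType) (eps : A -> S) (sec : S -> A).
Hypothesis secK : cancel sec eps.
Hypothesis sec0 : forall s, grA 0%N (sec s).
Hypothesis secD : {morph sec : s t / s + t}.
Hypothesis epsB : {morph eps : a b / a - b}.
Hypothesis epsM : {morph eps : a b / a * b}.

Let act (s : S) (a : A) := s * eps a.

Lemma tens_eqP (M : lmodType A) (D E : {freeg (S * M)}) :
  reflect (\pi_(tensor act M) D = \pi_(tensor act M) E)
          (D - E \in subgroup_of (@tensor_rel A S act M)).
Proof.
apply: (iffP idP) => [h|/eqP]; last by rewrite -Quotient.idealrBE.
by apply/eqP; rewrite -[_ == _]Quotient.idealrBE.
Qed.

Lemma tensDl (M : lmodType A) s s' (x : M) :
  tens act (s + s') x = tens act s x + tens act s' x.
Proof.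
rewrite /tens -[RHS](raddfD (\pi_(Quotient.quot _))); apply/tens_eqP/asboolP.
by rewrite opprD addrA; apply/SubgroupGen/TensorDl.
Qed.

Lemma tensDr (M : lmodType A) s (x x' : M) :
  tens act s (x + x') = tens act s x + tens act s x'.
Proof.
rewrite /tens -[RHS](raddfD (\pi_(Quotient.quot _))); apply/tens_eqP/asboolP.
by rewrite opprD addrA; apply/SubgroupGen/TensorDr.
Qed.

Lemma tensA (M : lmodType A) s a (x : M) :
  tens act (s * eps a) x = tens act s (a *: x).
Proof. by apply/tens_eqP/asboolP/SubgroupGen; exact: TensorA. Qed.

Lemma tens0 (M : lmodType A) (x : M) : tens act 0 x = 0.
Proof. by apply: (@addrI _ (tens act 0 x)); rewrite -tensDl !addr0. Qed.

Lemma tensr0 (M : lmodType A) s : tens act s (0 : M) = 0.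
Proof. by apply: (@addrI _ (tens act s (0 : M))); rewrite -tensDr !addr0. Qed.

Lemma tensBr (M : lmodType A) s (x x' : M) :
  tens act s (x - x') = tens act s x - tens act s x'.
Proof. by apply/eqP; rewrite eq_sym subr_eq -tensDr subrK. Qed.

Lemma tensE (M : lmodType A) s (x : M) : tens act s x = tens act 1 (sec s *: x).
Proof. by rewrite -tensA secK mul1r. Qed.

Lemma tensor_mapE (M M' : lmodType A) (f : {linear M -> M'}) s x :
  tensor_map act f (tens act s x) = tens act s (f x).
Proof. by rewrite /tens tensor_map_pi liftU scale1r. Qed.

Definition aug_span (M : lmodType A) : {pred M} :=
  subgroup_of (fun z : M => exists a x, eps a = 0 /\ z = a *: x).

(* S (x)_A M = M / A^+ M: the map (s, x) |-> sec s *: x kills the relations of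
   the tensor product modulo A^+ M. *)
Lemma tens1_eq0 (M : lmodType A) (x : M) :
  tens act 1 x = 0 -> x \in @aug_span M.
Proof.
move=> e0; have e1 : sec 1 *: x \in @aug_span M.
  have /tens_eqP : tens act 1 x = \pi_(tensor act M) 0.
    by rewrite e0; apply/esym; exact: (raddf0 (\pi_(Quotient.quot _))).
  rewrite subr0.
  pose F := fun sx : S * M => (sec sx.1 *: sx.2 : zmodule M).
  have FB : {morph fglift F : u v / u - v} by exact: lift_is_additive.
  have FU s y : fglift F <<(s, y)>> = sec s *: y by rewrite liftU scale1r.
  have F0 : fglift F 0 = 0 :> M by rewrite -(subrr 0) FB subrr.
  rewrite -(FU 1 x); move: <<(1, x)>> => D /asboolP; elim=> {D}.
  - by rewrite F0; exact: rpred0.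
  - move=> _ [s s' y|s y y'|s a y].
    + by rewrite !FB !FU secD scalerDl -addrA -opprD subrr; exact: rpred0.
    + by rewrite !FB !FU scalerDr -addrA -opprD subrr; exact: rpred0.
    + rewrite !FB !FU; apply/asboolP/SubgroupGen.
      exists (sec (s * eps a) - sec s * a), y; rewrite scalerBl -scalerA;
        split=> //.
      by rewrite epsB epsM !secK subrr.
  - by move=> D E _ hD _ hE; rewrite FB; exact: rpredB.
(* [sec] is not assumed to preserve 1, but [1 - sec 1] is killed by [eps]. *)
have -> : x = sec 1 *: x + (1 - sec 1) *: x by rewrite -scalerDl addrC subrK
  scale1r.
apply: rpredD => //; apply/asboolP/SubgroupGen; exists (1 - sec 1), x;
  split=> //.
have e11 : eps 1 = 1 by rewrite -[LHS]mul1r -{1}(secK 1) -epsM mulr1 secK.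
by rewrite epsB secK e11 subrr.
Qed.

(** Since [sec s] has degree 0, moving the coefficient into the right factor does not change the
    degree. *)
Lemma tensor_pcE (M : grmod grA) m z : z \in @tensor_pc A grA S eps M m ->
  exists2 x, gm_pc m x & z = tens act 1 x.
Proof.
move=> /asboolP; elim=> [|{}z [s [x [hx ->]]]|_ _ _ [x hx ->] _ [x' hx' ->]].
- by exists 0; [exact: gm_pc0 | rewrite tensr0].
- exists (sec s *: x); last exact: tensE.
  by rewrite -[m]add0n; apply: gm_act.
- by exists (x - x'); [exact: gm_pcB | rewrite tensBr].
Qed.

(** The class of [y] is a cycle of degree [m], hence a boundary, so [y] minus some [res_d F i.+1 x]
    lies in [A^+ F_{i+1}]. Applying [res_d F i] kills the subtracted term, which leaves
    [res_d F i y] in [A^+] times the image of [res_d F i]. *)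
Lemma Tor_vanishing (F : resolution grA eps) i m (y : res_mod F i.+1) :
  ~ Tor_neq0 grA eps i m -> gm_pc m y -> tens act 1 (res_d F i y) = 0 ->
  res_d F i y \in subgroup_of
    (fun z => exists a x, eps a = 0 /\ z = a *: res_d F i x).
Proof.
move=> htor hy ty0.
have [w hw ew] : exists2 w, w \in @tensor_pc A grA S eps (res_mod F i.+2) m
    & tens act 1 y = tensor_map act (res_d F i.+1) w.
  apply: contrapT => hn; apply: htor; exists F, (tens act 1 y); split=> //.
    by apply/asboolP/SubgroupGen; exists 1, y.
  by rewrite tensor_mapE.
have [x hx ex] := tensor_pcE hw.
have /tens1_eq0 : tens act 1 (y - res_d F i.+1 x) = 0.
  by rewrite tensBr ew ex tensor_mapE subrr.
have dd : res_d F i (res_d F i.+1 x) = 0 by apply/res_exact; exists x.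
have -> : res_d F i y = res_d F i (y - res_d F i.+1 x) by rewrite linearB dd
  subr0.
move: (y - _) => {dd hx ex hw ew ty0 hy}v /asboolP; elim=> {v}.
- by rewrite raddf0; exact: rpred0.
- move=> v [a [u [ea ->]]]; apply/asboolP/SubgroupGen; exists a, u.
  by rewrite linearZZ.
- by move=> u v _ hu _ hv; rewrite raddfB; exact: rpredB.
Qed.

End TensorVanishing.

(** * Degrees in the polynomial ring and Koszul syzygies *)

Section Degrees.
Variables (k : fieldType) (S : algType k) (n : nat).
Notation T := {mpoly S[n]}.
Implicit Types (x y t u : T).

Lemma Tle_lt m x : Tle m x <-> Tlt m.+1 x.
Proof. by split=> h mu /h; rewrite ltnS. Qed.

Lemma Tle0 m : Tle m (0 : T).
Proof. exact/Tle_lt/Tlt0. Qed.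

Lemma TleB m x y : Tle m x -> Tle m y -> Tle m (x - y).
Proof. by move=> /Tle_lt hx /Tle_lt hy; exact/Tle_lt/TltB. Qed.

Lemma Tle_mono m m' x : (m <= m')%N -> Tle m x -> Tle m' x.
Proof. by move=> h hx mu /hx h'; exact: leq_trans h' h. Qed.

Lemma Tlt_le m x : Tlt m x -> Tle m x.
Proof. by move=> hx mu /hx /ltnW. Qed.

Lemma Tle_msize x : Tle (msize x) x.
Proof. by move=> mu /msize_mdeg_lt /ltnW. Qed.

Lemma Tpc_mdeg m x mu : Tpc m x -> mu \in msupp x -> mdeg mu = m.
Proof. by move=> /dhomogP h /h. Qed.

Lemma Tpc_le m x : Tpc m x -> Tle m x.
Proof. by move=> /dhomogP h mu /h ->. Qed.

Lemma Tpc0 m : Tpc m (0 : T). Proof. exact: rpred0. Qed.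

Lemma TpcD m x y : Tpc m x -> Tpc m y -> Tpc m (x + y).
Proof. exact: rpredD. Qed.

Lemma TpcB m x y : Tpc m x -> Tpc m y -> Tpc m (x - y).
Proof. exact: rpredB. Qed.

Lemma TpcX (i : 'I_n) : Tpc 1 ('X_i : T).
Proof. by rewrite /Tpc dhomogX /= mdeg1. Qed.

Lemma TpcM d e x y : Tpc d x -> Tpc e y -> Tpc (d + e) (x * y).
Proof. exact: dhomogM. Qed.

Lemma TpcMX d x (i : 'I_n) : Tpc d x -> Tpc d.+1 (x * 'X_i).
Proof. by move=> hx; rewrite -addn1; apply: TpcM => //; exact: TpcX. Qed.

Lemma Tpc_sum d (J : finType) (F : J -> T) :
  (forall j, Tpc d (F j)) -> Tpc d (\sum_j F j).
Proof. by move=> h; apply: rpred_sum => j _; exact: h. Qed.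

Lemma prP m x : Tpc m (pr m x). Proof. exact: pihomogP. Qed.

Lemma TleM d e x y : Tle d x -> Tle e y -> Tle (d + e) (x * y).
Proof.
move=> hx hy mu /msuppM_le /allpairsP[[m1 m2] /= [/hx h1 /hy h2 ->]].
by rewrite mdegD leq_add.
Qed.

Lemma TltM1 d e x y : Tlt d x -> Tle e y -> Tlt (d + e) (x * y).
Proof.
move=> hx hy mu /msuppM_le /allpairsP[[m1 m2] /= [/hx h1 /hy h2 ->]].
by rewrite mdegD -addSn leq_add.
Qed.

Lemma TltM2 d e x y : Tle d x -> Tlt e y -> Tlt (d + e) (x * y).
Proof.
move=> hx hy mu /msuppM_le /allpairsP[[m1 m2] /= [/hx h1 /hy h2 ->]].
by rewrite mdegD -addnS leq_add.
Qed.

Lemma prB m x y : pr m (x - y) = pr m x - pr m y. Proof. exact: pihomogB. Qed.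
Lemma prD m x y : pr m (x + y) = pr m x + pr m y. Proof. exact: pihomogD. Qed.
Lemma pr0 m : pr m (0 : T) = 0. Proof. exact: pihomog0. Qed.

Lemma pr_sumT m (J : Type) (r : seq J) (Q : pred J) (F : J -> T) :
  pr m (\sum_(j <- r | Q j) F j) = \sum_(j <- r | Q j) pr m (F j).
Proof. exact: raddf_sum. Qed.

Lemma pr_Tpc d e x : Tpc d x -> pr e x = if d == e then x else 0.
Proof.
move=> hx; case: eqP => [<-|/eqP ne]; first exact: pihomog_dE.
exact: pihomog_ne0 ne hx.
Qed.

Lemma pr_lt m x : Tlt m x -> pr m x = 0.
Proof.
move=> hx; rewrite /pr pihomogE big_seq_cond big1 // => mu /andP[/hx h /eqP e].
by rewrite e ltnn in h.
Qed.

Lemma Tlt_pr0 m x : Tle m x -> pr m x = 0 -> Tlt m x.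
Proof.
move=> hx e; rewrite -[x]opprK -sub0r; apply: TltB; first exact: Tlt0.
by have := pr_top hx; rewrite e sub0r.
Qed.

Lemma Tle0_const x : Tle 0 x -> x = (x@_0%MM)%:MP.
Proof.
move=> hx; apply/mpolyP => mu; rewrite mcoeffC.
case: (eqVneq mu 0%MM) => [->|ne]; first by rewrite mulr1.
rewrite mulr0; apply: memN_msupp_eq0; apply/negP => /hx.
by rewrite leqn0 mdeg_eq0 (negbTE ne).
Qed.

Lemma Tle_const m (c : S) : Tle m (c%:MP : T).
Proof. by move=> mu; rewrite msuppC; case: eqP => // _; rewrite inE =>
  /eqP ->; rewrite mdeg0. Qed.

Lemma pr_dec x : exists N, forall M, (N <= M)%N -> x = \sum_(d < M) pr d x.
Proof. by exists (msize x) => M h; exact: pihomog_partitionE. Qed.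

(** Replacing either factor by its leading form changes the product only in degrees below
    [d + e]. *)
Lemma prM_top d e x y : Tle d x -> Tle e y ->
  pr (d + e) (x * y) = pr d x * pr e y.
Proof.
move=> hx hy; apply/eqP; rewrite eq_sym -subr_eq0; apply/eqP.
have {1}-> : pr d x * pr e y = pr (d + e) (pr d x * pr e y).
  by rewrite (pr_Tpc _ (TpcM (prP d x) (prP e y))) eqxx.
rewrite -prB; apply: pr_lt.
have -> : pr d x * pr e y - x * y = (pr d x - x) * y + pr d x * (pr e y - y).
  by rewrite mulrBl mulrBr [RHS]addrC addrA subrK.
apply: TltD; first exact: TltM1 (pr_top hx) hy.
by apply: TltM2 (pr_top hy); exact: Tpc_le (prP _ _).
Qed.

Lemma prMl d m a x : Tpc d a ->
  pr m (a * x) = if (d <= m)%N then a * pr (m - d) x else 0.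
Proof.
move=> ha; have [N hN] := pr_dec x.
rewrite {1}(hN (N + m.+1)%N (leq_addr _ _)) mulr_sumr pr_sumT.
have h (i : nat) : pr m (a * pr i x) = if (d + i)%N == m then a * pr i x else 0.
  exact: pr_Tpc (TpcM ha (prP i x)).
case: (leqP d m) => hd; last first.
  rewrite big1 // => i _; rewrite h; case: eqP => // e.
  by have := leq_addr i d; rewrite e leqNgt hd.
have hi : (m - d < N + m.+1)%N by rewrite (leq_ltn_trans (leq_subr _ _)) //
  leq_addl.
rewrite (bigD1 (Ordinal hi)) //= big1 ?addr0 => [|i ne];
  first by rewrite h subnKC ?eqxx.
rewrite h; case: eqP => // e; case/eqP: ne; apply: val_inj => /=.
by apply/eqP; rewrite -(eqn_add2l d) e subnKC.
Qed.

Lemma prMr d m a x : Tpc d a ->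
  pr m (x * a) = if (d <= m)%N then pr (m - d) x * a else 0.
Proof.
move=> ha; have [N hN] := pr_dec x.
rewrite {1}(hN (N + m.+1)%N (leq_addr _ _)) mulr_suml pr_sumT.
have h (i : nat) : pr m (pr i x * a) = if (i + d)%N == m then pr i x * a else 0.
  exact: pr_Tpc (TpcM (prP i x) ha).
case: (leqP d m) => hd; last first.
  rewrite big1 // => i _; rewrite h; case: eqP => // e.
  by have := leq_addl i d; rewrite e leqNgt hd.
have hi : (m - d < N + m.+1)%N by rewrite (leq_ltn_trans (leq_subr _ _)) //
  leq_addl.
rewrite (bigD1 (Ordinal hi)) //= big1 ?addr0 => [|i ne];
  first by rewrite h subnK ?eqxx.
rewrite h; case: eqP => // e; case/eqP: ne; apply: val_inj => /=.
by apply/eqP; rewrite -(eqn_add2r d) e subnK.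
Qed.

Lemma commX (i : 'I_n) x : x * 'X_i = 'X_i * x.
Proof. exact: commr_mpolyX. Qed.

Lemma prMX m x (i : 'I_n) : pr m.+1 (x * 'X_i) = pr m x * 'X_i.
Proof. by rewrite commX (prMl _ _ (TpcX i)) /= subn1 -commX. Qed.

Definition Tgrading : grading (@Tpc k S n).
Proof.
refine (@Grading T _ (@pr k S n) prB prP pr_Tpc pr_dec Tpc0 _ TpcB TpcM).
exact: dhomog1.
Defined.

(** Each monomial of [f] is assigned to one variable of [Q] that divides it, and [h i] collects the
    quotients of the monomials assigned to [i]. *)
Lemma div_supp (f : T) (Q : pred 'I_n) :
  (forall mu, mu \in msupp f -> exists2 i, Q i & (0 < mu i)%N) ->
  exists h : 'I_n -> T, f = \sum_(i | Q i) h i * 'X_i /\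
    forall i nu, nu \in msupp (h i) -> (nu + U_(i))%MM \in msupp f.
Proof.
move=> hf; pose pk (mu : 'X_{1..n}) := [pick i | Q i && (0 < mu i)%N].
have pkP mu i : pk mu = Some i -> (0 < mu i)%N.
  by rewrite /pk; case: pickP => // j /andP[_ hj] [<-].
exists (fun i => \sum_(mu <- msupp f |
  pk mu == Some i) f@_mu *: 'X_[mu - U_(i)]).
split.
  under eq_bigr => i _ do rewrite mulr_suml.
  rewrite (exchange_big_dep predT) //= [LHS]mpolyE big_seq [RHS]big_seq.
  apply: eq_bigr => mu /hf [i0 Qi0 hi0]; rewrite /pk.
  case: pickP => [i /andP[Qi hi]|/(_ i0)]; last by rewrite Qi0 hi0.
  rewrite (big_pred1 i) => [|j]; last first.
    rewrite /= [RHS]eq_sym; case: (eqVneq i j) => [<-|ne];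
      first by rewrite Qi eqxx.
    by rewrite andbC; case: eqP => // -[e]; rewrite e eqxx in ne.
  rewrite -scalerAl -mpolyXD submK //; apply/mnm_lepP => j; rewrite mnm1E.
  by case: eqP => // <-.
move=> i; rewrite big_seq_cond.
elim/big_ind: _ => [|u v hu hv|mu /andP[hmu /eqP/pkP hj]] nu.
- by rewrite msupp0.
- by move=> /msuppD_le; rewrite mem_cat => /orP[/hu|/hv].
move=> /msuppZ_le /mem_msuppXP <-.
rewrite submK //; apply/mnm_lepP => j; rewrite mnm1E.
by case: eqP => // <-.
Qed.

Lemma mnm_pos (mu : 'X_{1..n}) : mu != 0%MM -> exists i, (0 < mu i)%N.
Proof.
move=> ne; apply: contrapT => h; case/eqP: ne; apply/mnmP => i; rewrite mnm0E.
by apply/eqP; rewrite -leqn0 leqNgt; apply/negP => hi; apply: h; exists i.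
Qed.

Lemma Tle_div m x : Tle m.+1 x -> exists (c : S) (h : 'I_n -> T),
  (forall i, Tle m (h i)) /\ x = c%:MP + \sum_i h i * 'X_i.
Proof.
move=> hx; set x1 := x - (x@_0%MM)%:MP.
have h0 : x1@_0%MM = 0 by rewrite /x1 mcoeffB mcoeffC eqxx mulr1 subrr.
have [|h [eh hh]] := @div_supp x1 predT.
  move=> mu hmu; have [|i hi] := @mnm_pos mu; last by exists i.
  by apply: contraTneq hmu => ->; rewrite mcoeff_msupp h0 eqxx.
exists (x@_0%MM), h; split; last by rewrite -eh addrC subrK.
move=> i nu /hh hnu; suff : (mdeg (nu + U_(i))%MM <= m.+1)%N by rewrite mdegD
  mdeg1 addn1.
by move: hnu; apply: TleB => //; exact: Tle_const.
Qed.

(** The Koszul syzygy [g (X_j e_i - X_i e_j)], given by its coordinates. *)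
Definition koszul (i j : 'I_n) (g : T) : 'I_n -> T :=
  fun l => (if l == i then g * 'X_j else 0) - (if l == j then g * 'X_i else 0).

Lemma koszulE i j g : \sum_l koszul i j g l * 'X_l = 0.
Proof.
under eq_bigr => l _ do rewrite /koszul mulrBl.
rewrite sumrB (bigD1 i) //= eqxx big1 => [|l /negbTE ->]; last by rewrite mul0r.
rewrite (bigD1 j) //= eqxx big1 => [|l /negbTE ->]; last by rewrite mul0r.
by rewrite !addr0 -!mulrA -!mpolyXD addmC subrr.
Qed.

Lemma koszul_Tpc i j g d l : Tpc d g -> Tpc d.+1 (koszul i j g l).
Proof.
move=> hg; rewrite /koszul; apply: TpcB; case: ifP => _;
  by [exact: TpcMX | exact: Tpc0].
Qed.

Lemma koszulN i j g l : koszul i j (- g) l = - koszul i j g l.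
Proof.
by rewrite /koszul !mulNr opprB addrC; congr (_ + _); case: ifP;
  rewrite ?opprK ?oppr0.
Qed.

(* Exactness of the Koszul complex at its first syzygies, by induction on the
   number of nonzero components: each monomial of the last one is divisible by
   an earlier variable, so Koszul syzygies cancel it. *)
Lemma koszul_ind d (Q : ('I_n -> T) -> Prop) :
  Q (fun=> 0) -> (forall f g, Q f -> Q g -> Q (fun l => f l + g l)) ->
  (forall i j g, Tpc d g -> Q (koszul i j g)) ->
  forall f, (forall i, Tpc d.+1 (f i)) -> \sum_i f i * 'X_i = 0 -> Q f.
Proof.
move=> Q0 QD QK f hf ef.
suff H (r : nat) g : (forall i, Tpc d.+1 (g i)) -> \sum_i g i * 'X_i = 0 ->
    (forall i : 'I_n, (r <= i)%N -> g i = 0) -> Q g.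
  by apply: (H n f) => // i; rewrite leqNgt ltn_ord.
elim: r g {hf ef f} => [|r IH] g hg eg g0.
  by have -> : g = fun=> 0 by apply: funext => i; exact: g0.
have [hr|hr] := ltnP r n; last first.
  apply: IH => // i hi; move: (ltn_ord i).
  by rewrite ltnNge (leq_trans hr hi).
pose i0 := Ordinal hr.
(* If [mu] occurs in [g i0] and no earlier variable divides it, then the monomial [X_i0 mu] comes
   from the term [i0] alone, since later components vanish, and the sum cannot be zero. *)
have [|h [eh hh]] := @div_supp (g i0) (fun i : 'I_n => i < r)%N.
  move=> mu hmu; apply: contrapT => hn.
  have : (\sum_i g i * 'X_i)@_(U_(i0) + mu)%MM = 0 by rewrite eg mcoeff0.
  rewrite raddf_sum (bigD1 i0) //= mcoeffMX big1 ?addr0 => [e|i ne].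
    by move: hmu; rewrite mcoeff_msupp e eqxx.
  apply: memN_msupp_eq0; apply/negP => hs.
  have [hi|hi] := ltnP i r; last first.
    have hi' : (r < i)%N by rewrite ltn_neqAle hi andbT;
      apply: contraNneq ne => e; apply/eqP/val_inj.
    by move: hs; rewrite g0 // mul0r msupp0.
  move: hs => /msuppM_le /allpairsP[[m1 m2] /= [_ /mem_msuppXP <- em]].
  apply: hn; exists i => //; have := congr1 (fun m : 'X_{1..n} => m i) em.
  by rewrite /= !mnmDE !mnm1E eqxx eq_sym (negbTE ne) add0n => ->;
    rewrite addn1.
have hT i : Tpc d (h i).
  apply/dhomogP => nu /hh hnu; move/dhomogP: (hg i0) => /(_ _ hnu).
  by rewrite /= mdegD mdeg1 addn1 => -[].
have Qsum (s : seq 'I_n) (G : 'I_n -> 'I_n -> T) :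
    (forall i, Q (G i)) -> Q (fun l => \sum_(i <- s | (i < r)%N) G i l).
  move=> hG; elim: s => [|i s IHs].
    have -> // : (fun l => \sum_(i <- [::] : seq 'I_n |
      (i < r)%N) G i l) = fun=> 0.
    by apply: funext => l; rewrite big_nil.
  have -> : (fun l => \sum_(j <- i :: s | (j < r)%N) G j l) = fun l =>
      (if (i < r)%N then G i else fun=> 0) l + \sum_(j <- s | (j < r)%N) G j l.
    by apply: funext => l; rewrite big_cons; case: ifP => // _; rewrite add0r.
  by apply: QD => //; case: ifP.
(* At [i0] this sum is [- g i0], so [g + K] is a syzygy supported on the indices below [r]; the
   negated Koszul syzygies restore [g]. *)
pose K l := \sum_(i < n | (i < r)%N) koszul i i0 (h i) l.
have -> : g = fun l => (g l + K l) + \sum_(i < n |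
  (i < r)%N) koszul i i0 (- h i) l.
  apply: funext => l; rewrite -addrA -big_split /= big1 ?addr0 // => i _.
  by rewrite koszulN subrr.
apply: QD; last first.
  by apply: Qsum => i; apply: QK; rewrite /Tpc rpredN; exact: hT.
apply: IH => [i||l hl].
- apply: TpcD => //; apply: rpred_sum => j _; apply: koszul_Tpc.
  exact: hT.
- under eq_bigr => l _ do rewrite mulrDl mulr_suml.
  rewrite big_split /= eg add0r exchange_big /= big1 // => i _; exact: koszulE.
rewrite /K; under eq_bigr => i hi.
  rewrite /koszul ifF; last by apply/negbTE; apply: contraTneq hl => ->;
    rewrite -ltnNge.
  rewrite sub0r; over.
rewrite sumrN; case: (eqVneq l i0) => [->|ne].
  by rewrite -eh subrr.
rewrite big1 // subr0 g0 // ltn_neqAle hl andbT.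
by apply: contraNneq ne => e; apply/eqP/val_inj.
Qed.

End Degrees.

(** * The filtration P_m and the PBW property *)

Section Filtration.
Variables (k : fieldType) (S : algType k) (n : nat).
Notation T := {mpoly S[n]}.
Variables (P : T -> Prop).
Implicit Types (x y t u : T).

Lemma Pfil_gen m i j l t p u : (i + j + l <= m)%N ->
  Tle i t -> P p -> Tle j p -> Tle l u -> t * p * u \in Pfil P m.
Proof.
move=> h ht hp hj hu; apply/asboolP/SubgroupGen.
(* The slack is absorbed by the degree bound on the left factor. *)
exists (i + (m - (i + j + l)))%N, j, l, t, p, u; split=> //; last first.
  by apply: Tle_mono ht; exact: leq_addr.
lia.
Qed.

Lemma PfilB m x y : x \in Pfil P m -> y \in Pfil P m -> x - y \in Pfil P m.
Proof. exact: (rpredB (S := subgroup_of _)). Qed.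

Lemma PfilD m x y : x \in Pfil P m -> y \in Pfil P m -> x + y \in Pfil P m.
Proof. exact: (rpredD (S := subgroup_of _)). Qed.

Lemma Pfil0 m : 0 \in Pfil P m.
Proof. exact: (rpred0 (subgroup_of _)). Qed.

Lemma Pfil_sum m (J : finType) (F : J -> T) :
  (forall j, F j \in Pfil P m) -> \sum_j F j \in Pfil P m.
Proof. by move=> h; elim/big_ind: _ => [|u v|j _] //; [exact: Pfil0 |
  exact: PfilD]. Qed.

Lemma Pfil_ind m (Q : T -> Prop) :
  Q 0 -> (forall x y, Q x -> Q y -> Q (x - y)) ->
  (forall i j l t p u, (i + j + l)%N = m -> Tle i t -> P p -> Tle j p ->
    Tle l u ->
    Q (t * p * u)) ->
  forall x, x \in Pfil P m -> Q x.
Proof.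
move=> Q0 QB Qg x /asboolP; elim=> // [|{}x y _ hx _ hy]; last exact: QB.
by move=> _ [i [j [l [t [p [u [e ht [hp hj] hu ->]]]]]]]; apply: (Qg i j l).
Qed.

Lemma Pfil_le m x : x \in Pfil P m -> Tle m x.
Proof.
apply: Pfil_ind => [|y z|i j l t p u <- ht _ hp hu]; first exact: Tle0.
  exact: TleB.
by apply: TleM => //; exact: TleM.
Qed.

Lemma Pfil_mono m m' x : (m <= m')%N -> x \in Pfil P m -> x \in Pfil P m'.
Proof.
move=> h; apply: (Pfil_ind (Q := fun x => x \in Pfil P m')) =>
  [|y z|i j l t p u e ht hp hj hu]; first exact: Pfil0.
  exact: PfilB.
by apply: (@Pfil_gen _ i j l) => //; rewrite e.
Qed.

Lemma PfilMl d m a x : Tle d a -> x \in Pfil P m -> a * x \in Pfil P (d + m).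
Proof.
move=> ha; apply: (Pfil_ind (Q := fun x => a * x \in _)).
- by rewrite mulr0; exact: Pfil0.
- by move=> y z hy hz; rewrite mulrBr; exact: PfilB.
- move=> i j l t p u e ht hp hj hu; rewrite !mulrA.
  by apply: (@Pfil_gen _ (d + i) j l) => //;
    [rewrite -!addnA leq_add2l addnA e | exact: TleM].
Qed.

Lemma PfilMr d m a x : Tle d a -> x \in Pfil P m -> x * a \in Pfil P (m + d).
Proof.
move=> ha; apply: (Pfil_ind (Q := fun x => x * a \in _)).
- by rewrite mul0r; exact: Pfil0.
- by move=> y z hy hz; rewrite mulrBl; exact: PfilB.
- move=> i j l t p u e ht hp hj hu; rewrite -mulrA.
  by apply: (@Pfil_gen _ i j (l + d)) => //; [rewrite addnA e | exact: TleM].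
Qed.

Lemma PfilMX m x (i : 'I_n) : x \in Pfil P m -> x * 'X_i \in Pfil P m.+1.
Proof. by move=> hx; rewrite -addn1; apply: PfilMr => //; exact/Tpc_le/TpcX.
  Qed.

Lemma Pfil_P m p : P p -> Tle m p -> p \in Pfil P m.
Proof.
move=> hp hm; rewrite -[p]mul1r -[_ * _]mulr1.
have h1 : Tle 0 (1 : T) by apply: Tpc_le; exact: dhomog1.
by apply: (@Pfil_gen _ 0 m 0) => //; rewrite addn0.
Qed.

Lemma Pfil_ideal m x : x \in Pfil P m -> ideal_spec P x.
Proof.
apply: (Pfil_ind (Q := ideal_spec P)) => [|y z|i j l t p u _ _ hp _ _];
  first exact: Ideal0.
  exact: IdealB.
by apply/IdealMr/IdealMl/IdealGen.
Qed.

Lemma ideal_Pfil x : ideal_spec P x -> exists m, x \in Pfil P m.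
Proof.
elim=> {x} [|y hy|x y _ [m hx] _ [m' hy]|a x _ [m hx]|x a _ [m hx]].
- by exists 0%N; exact: Pfil0.
- by exists (msize y); apply: Pfil_P => //; exact: Tle_msize.
- exists (m + m')%N; apply: PfilB.
    by apply: Pfil_mono hx; exact: leq_addr.
  by apply: Pfil_mono hy; exact: leq_addl.
- by exists (msize a + m)%N; apply: PfilMl => //; exact: Tle_msize.
- by exists (m + msize a)%N; apply: PfilMr => //; exact: Tle_msize.
Qed.

Hypothesis hP : subbimod P.

(** Leading forms are multiplicative, and the middle factor of a generator contributes an element of
    [R_P]. *)
Lemma Pfil_lead m x : x \in Pfil P m -> pr m x \in ideal_of (Rof P).
Proof.
apply: (Pfil_ind (Q := fun x => pr m x \in ideal_of (Rof P))) =>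
  [|y z hy hz|i j l t p u <- ht hp hj hu].
- by rewrite pr0; exact: (rpred0 (ideal_of _)).
- by rewrite prB; exact: rpredB.
rewrite prM_top //; last exact: TleM.
rewrite prM_top //; apply/ideal_of_mulr/ideal_of_mull/asboolP/IdealGen => d.
rewrite (pr_Tpc d (prP j p)); case: eqP => [<-|_]; first by exists p.
by case: hP => P0 _ _ _; exists 0; rewrite pr0; split=> //; exact: Tle0.
Qed.



(** If an outer factor of a generator [t * p * u] has positive degree bound, its variables are split
    off and, being central, moved to the far right; its constant term goes to [z]. If both bounds
    are 0, the outer factors are scalars and the product stays in [P]. *)
Lemma Pfil_decomp m x : x \in Pfil P m.+1 ->
  exists p (w : 'I_n -> T) z, [/\ P p, Tle m.+1 p, forall i, w i \in Pfil P m,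
    z \in Pfil P m & x = p + \sum_i w i * 'X_i + z].
Proof.
have [P0 PB Pl Pr] := hP.
pose Q x := exists p (w : 'I_n -> T) z, [/\ P p, Tle m.+1 p,
  forall i, w i \in Pfil P m, z \in Pfil P m & x = p + \sum_i w i * 'X_i + z].
apply: (Pfil_ind (Q := Q)) =>
  [|_ _ [p [w [z [hp lp hw hz ->]]]] [p' [w' [z' [hp' lp' hw' hz' ->]]]]|].
- exists 0, (fun=> 0), 0; split=> //; [exact: Tle0 | by move=> _;
  exact: Pfil0 | exact: Pfil0 |].
  by rewrite big1 ?addr0 // => i _; rewrite mul0r.
- exists (p - p'), (fun i => w i - w' i), (z - z'); split.
  + exact: PB.
  + exact: TleB.
  + by move=> i; exact: PfilB.
  + exact: PfilB.
  + have -> : \sum_i (w i - w' i) * 'X_i = \sum_i w i * 'X_i - \sum_i w' i *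
    'X_i.
      by rewrite -sumrB; apply: eq_bigr => i _; rewrite mulrBl.
    by rewrite opprD addrACA; congr (_ + _); rewrite opprD addrACA.
- move=> [|i] j l t p u e ht hp hj hu; last first.
    have [c [h [hh ->]]] := Tle_div ht.
    exists 0, (fun a => h a * p * u), (c%:MP * p * u); split=> //;
      first exact: Tle0.
    + by move=> a; apply: (@Pfil_gen _ i j l) => //; rewrite -ltnS -e.
    + by apply: (@Pfil_gen _ 0 j l) => //; [lia | exact: Tle_const].
    + rewrite add0r [RHS]addrC !mulrDl !mulr_suml; congr (_ + _).
      apply: eq_bigr => a _.
      by rewrite -[h a * _ * p]mulrA -(commX a p) mulrA -[_ * u]mulrA -(commX a
        u) mulrA.
  case: l e hu => [|l] e hu; last first.
    have [c [h [hh ->]]] := Tle_div hu.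
    exists 0, (fun a => t * p * h a), (t * p * c%:MP); split=> //;
      first exact: Tle0.
    + by move=> a; apply: (@Pfil_gen _ 0 j l) => //; lia.
    + by apply: (@Pfil_gen _ 0 j 0) => //; [lia | exact: Tle_const].
    + rewrite add0r [RHS]addrC mulrDr mulr_sumr; congr (_ + _).
      by apply: eq_bigr => a _; rewrite mulrA.
  exists (t * p * u), (fun=> 0), 0; split.
  + by rewrite (Tle0_const ht) (Tle0_const hu); exact/Pr/Pl.
  + by rewrite -e; apply: TleM => //; exact: TleM.
  + by move=> _; exact: Pfil0.
  + exact: Pfil0.
  + by rewrite big1 ?addr0 // => i _; rewrite mul0r.
Qed.

End Filtration.

(** * PBW type amounts to all the Jacobi conditions *)

Section PBW.
Variables (k : fieldType) (S : algType k) (n : nat).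
Notation T := {mpoly S[n]}.
Variables (I : twoSidedIdeal T) (R P : T -> Prop).
Hypothesis hI : graded (fun x => x \in I).
Hypothesis hR : bimod_of_relations I R.
Hypothesis hR2 : forall x, R x -> Tge 2 x.
Hypothesis hP : subbimod P.
Hypothesis hRof : forall x, Rof P x <-> R x.
Implicit Types (x y t u : T).

Lemma Rof_pr m p : P p -> Tle m p -> R (pr m p).
Proof.
move=> hp lp; apply/hRof => d; rewrite (pr_Tpc d (prP m p)).
case: eqP => [<-|_]; first by exists p.
by case: hP => P0 _ _ _; exists 0; rewrite pr0; split=> //; exact: Tle0.
Qed.

(** The leading form of [p] lies in [R], which has nothing in degrees 1 and 0; two successive drops
    in degree leave no monomial. *)
Lemma P_low p : P p -> Tle 1 p -> p = 0.
Proof.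
have low m q : (m < 2)%N -> P q -> Tle m q -> Tlt m q.
  move=> hm hq lq; apply: Tlt_pr0 => //; have /hR2 h2 := Rof_pr hq lq.
  apply/eqP/negPn/negP => nz.
  have hs : mlead (pr m q) \in msupp (pr m q) by exact: mlead_supp.
  by have := h2 _ hs; rewrite (Tpc_mdeg (prP m q) hs) leqNgt hm.
move=> hp lp; have l0 : Tle 0 p by apply/Tle_lt; exact: low lp.
have l1 := low 0%N p isT hp l0.
apply/eqP/negPn/negP => nz; have := l1 _ (mlead_supp nz); by [].
Qed.

Lemma Pfil_low m x : (m < 2)%N -> x \in Pfil P m -> x = 0.
Proof.
move=> hm; apply: (Pfil_ind (Q := fun x => x = 0)) => //.
  by move=> y z -> ->; rewrite subrr.
move=> i j l t p u e _ hp lp _; rewrite (P_low hp) ?mulr0 ?mul0r //.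
by apply: Tle_mono lp; lia.
Qed.

Lemma R_I x : R x -> x \in I. Proof. by case: hR => _ _ h _ _; exact: h. Qed.

Lemma ideal_R x : x \in ideal_of (Rof P) -> x \in I.
Proof.
move=> /asboolP; elim=> {x} [|y /hRof /R_I //|x y _ hx _ hy|a x _|x a _].
- exact: rpred0.
- exact: rpredB.
- exact: ideal_mull.
- exact: ideal_mulr.
Qed.

Lemma lead_in m x : x \in Pfil P m -> pr m x \in I.
Proof. by move=> hx; apply/ideal_R/Pfil_lead. Qed.

(** Induction on the degree along [I = R + (T^1 I + I T^1)]. A component of the [R] part is by
    [R_P = R] the leading form of an element of [P]; a decomposable [t * x] or [x * t] reduces to
    the component of [x] one degree lower. In degree 0 the decomposables contribute nothing. *)
Lemma lead_I m y : y \in I -> exists2 c, c \in Pfil P m & pr m c = pr m y.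
Proof.
have [_ gR _ _ hdec] := hR.
elim: m y => [|m IH] y yI; have [r [w [hr hw ->]]] := hdec y yI; rewrite prD.
  have [p [hp lp ->]] := (iffRL (hRof _) hr) 0%N.
  exists p; first exact: Pfil_P.
  suff -> : pr 0 w = 0 by rewrite addr0.
  move/asboolP: hw; elim=> {w} [|w [t [x [ht _ [->|->]]]]|u v _ hu _ hv].
  - exact: pr0.
  - by rewrite (prMl _ _ ht).
  - by rewrite (prMr _ _ ht).
  - by rewrite prB hu hv subrr.
have [p [hp lp ->]] := (iffRL (hRof _) hr) m.+1.
suff [c hc <-] : exists2 c, c \in Pfil P m.+1 & pr m.+1 c = pr m.+1 w.
  by exists (p + c); [apply: PfilD => //; exact: Pfil_P | rewrite prD].
move/asboolP: hw; elim=> {w} [|w [t [x [ht xI e]]]|u v _ [c hc ec] _ [c' hc'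
  ec']].
- by exists 0; [exact: Pfil0 | rewrite pr0].
- have [c hc ec] := IH x xI.
  case: e => ->.
    exists (t * c); first by rewrite -add1n; apply: PfilMl => //; exact: Tpc_le.
    by rewrite !(prMl _ _ ht) /= subn1 ec.
  exists (c * t); first by rewrite -addn1; apply: PfilMr => //; exact: Tpc_le.
  by rewrite !(prMr _ _ ht) /= subn1 ec.
- by exists (c - c'); [exact: PfilB | rewrite !prB ec ec'].
Qed.

(** Each condition with [m <= j < M] lowers the index by one, as [x] has degree at most [m <= j]. *)
Lemma Pfil_desc m M x : (forall j, (m <= j < M)%N -> jacobi P j) ->
  x \in Pfil P M -> Tle m x -> x \in Pfil P m.
Proof.
elim: M => [|M IH] hJ hx lx; first by apply: Pfil_mono hx.
case: (leqP M.+1 m) => h; first exact: Pfil_mono hx.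
apply: IH => // [j /andP[h1 h2]|]; first by apply: hJ; rewrite h1 ltnS ltnW.
apply: hJ => //; first by rewrite -ltnS h /=.
by apply: Tle_mono lx.
Qed.

Lemma U_eqP x y : \pi_(U P) x = \pi_(U P) y <-> x - y \in ideal_of P.
Proof. by split=> /(@quor_eqP _ (ideal_of P) x y). Qed.

Lemma Uquo_eqP m x y :
  \pi_(Uquo P m) (\pi_(U P) x) = \pi_(Uquo P m) (\pi_(U P) y) <->
  exists2 t, Tlt m t & x - y - t \in ideal_of P.
Proof.
have e : (\pi_(Uquo P m) (\pi_(U P) x) = \pi_(Uquo P m) (\pi_(U P) y)) <->
    \pi_(U P) x - \pi_(U P) y \in @Ult k S n P m.
  split=> [/eqP|h]; first by rewrite -Quotient.idealrBE.
  by apply/eqP; rewrite -[_ == _]Quotient.idealrBE.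
have eB : \pi_(U P) x - \pi_(U P) y = \pi_(U P) (x - y).
  exact/esym/(raddfB (\pi_(Quotient.quot (ideal_of P)))).
rewrite e eB; split=> [/asboolP[t ht /U_eqP h]|[t ht h]]; first by exists t.
by apply/asboolP; exists t => //; apply/U_eqP.
Qed.

Lemma jacobi0 : jacobi P 0.
Proof. by move=> x /(Pfil_low (isT : (1 < 2)%N)) -> _; exact: Pfil0. Qed.

(** The conditions force the ideal of [P] to meet [T^{<= m}] in [P_m], whose leading forms lie in
    the ideal of [R_P]: this is injectivity. For surjectivity, the leading forms of representatives
    of the components add up to a preimage. *)
Lemma jacobi_PBW : (forall m, (1 <= m)%N -> jacobi P m) -> PBW_type P.
Proof.
move=> hJ; have {}hJ m : jacobi P m by case: m => [|m]; [exact: jacobi0 |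
  exact: hJ].
have hfil m x : x \in ideal_of P -> Tle m x -> x \in Pfil P m.
  by move=> /asboolP/ideal_Pfil[M hM]; apply: Pfil_desc hM.
split.
- elim/quotW=> x; elim/quotW=> y e; apply/quor_eqP.
  have [N ->] : exists N, x - y = \sum_(d < N) pr d (x - y).
    by have [N hN] := pr_dec (x - y); exists N; exact: hN.
  (* Equality in degree [d] gives [t] of degree below [d] with [pr d (x - y) - t] in the ideal of
     [P]; the leading form of this element is [pr d (x - y)]. *)
  apply: rpred_sum => d _; have := e d.
  rewrite !PhiE => /Uquo_eqP[t ht h].
  rewrite -prB in h; have l : Tle d (pr d (x - y) - t).
    by apply: TleB; [exact/Tpc_le/prP | exact: Tlt_le].
  have := Pfil_lead hP (hfil _ _ h l).
  by rewrite prB (pr_lt ht) subr0 (pr_Tpc _ (prP d _)) eqxx.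
- move=> f [hf [N hN]].
  have ht m : exists t, Tle m t /\ f m = \pi_(Uquo P m) (\pi_(U P) t).
    by have [a /asboolP[t lt ->] ->] := hf m; exists t.
  pose t m := projT1 (cid (ht m)).
  have tP m : Tle m (t m) /\ f m = \pi_(Uquo P m) (\pi_(U P) (t m)).
    exact: projT2 (cid (ht m)).
  pose x := \sum_(d < N) pr d (t d).
  exists (\pi x) => m; rewrite PhiE; have [lt ->] := tP m.
  have ex : pr m x = if (m < N)%N then pr m (t m) else 0.
    rewrite /x pr_sumT; case: ltnP => hm.
      rewrite (bigD1 (Ordinal hm)) //= big1 => [|i ne].
        by rewrite addr0 (pr_Tpc _ (prP m _)) eqxx.
      rewrite (pr_Tpc _ (prP i _)); case: eqP => // e.
      by case/eqP: ne; exact: val_inj.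
    rewrite big1 // => i _; rewrite (pr_Tpc _ (prP i _)); case: eqP => // e.
    by have := ltn_ord i; rewrite e ltnNge hm.
  rewrite ex; case: ltnP => hm; last first.
    rewrite -(tP m).2 hN //;
      rewrite [X in \pi_(Uquo P m) X](raddf0 (\pi_(Quotient.quot (ideal_of
        P)))).
    exact: (raddf0 (\pi_(Quotient.quot _))).
  apply/Uquo_eqP; exists (pr m (t m) - t m); first exact: pr_top.
  by rewrite subrr; exact: (rpred0 (ideal_of _)).
Qed.

(** By injectivity, the leading form of an element of the ideal of [P] lies in [I], so by [lead_I]
    it is also that of an element of the filtration. Subtracting that element lowers the degree, and
    induction puts every element of the ideal of degree at most [d] into [P_d]. *)
Lemma PBW_jacobi m : PBW_type P -> jacobi P m.
Proof.
move=> [inj _]; suff h d x : x \in ideal_of P -> Tle d x -> x \in Pfil P d.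
  by move=> x hx; apply: h; apply/asboolP/Pfil_ideal/hx.
have key e y : y \in ideal_of P -> Tle e y -> pr e y \in I.
  move=> hy ly; suff : \pi_(quor (ideal_of (Rof P))) (pr e y) = \pi_(quor
    (ideal_of (Rof P))) 0.
    by move/quor_eqP; rewrite subr0; exact: ideal_R.
  apply: inj => j; rewrite !PhiE; apply/Uquo_eqP; rewrite pr0 subr0.
  rewrite (pr_Tpc _ (prP e y)); case: eqP => [<-|_]; last first.
    by exists 0; [exact: Tlt0 | rewrite subr0; exact: (rpred0 (ideal_of _))].
  by exists (pr e y - y); [exact: pr_top | rewrite opprB addrC subrK].
have lead e y : y \in ideal_of P -> Tle e y -> exists2 c, c \in Pfil P e &
  pr e c = pr e y.
  move=> hy ly; have [c hc ec] := lead_I e (key _ _ hy ly).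
  by exists c => //; rewrite ec (pr_Tpc _ (prP _ _)) eqxx.
elim: d x => [|d IH] x hx lx; have [c hc ec] := lead _ _ hx lx.
  (* In degree 0 the comparison element lies in [P_0 = 0], so [x] has no monomial left. *)
  rewrite (Pfil_low _ hc) // pr0 in ec.
  have : Tlt 0 x by apply: Tlt_pr0.
  move=> h; suff -> : x = 0 by exact: Pfil0.
  by apply/eqP; apply/negPn/negP => /mlead_supp /h.
rewrite -[x](subrK c); apply: PfilD => //; apply: (Pfil_mono (leqnSn d)).
apply: IH; first by apply: rpredB => //; apply/asboolP/Pfil_ideal/hc.
apply/Tle_lt; apply: Tlt_pr0; last by rewrite prB ec subrr.
by apply: TleB => //; exact: Pfil_le hc.
Qed.

End PBW.

(** * The graded ring A = T/I and lifts from A to T *)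

Section QuotientAlgebra.
Variables (k : fieldType) (S : algType k) (n : nat).
Notation T := {mpoly S[n]}.
Variable I : twoSidedIdeal T.
Notation A := (quor I).
Hypothesis hI : graded (fun x => x \in I).
Hypothesis hI0 : forall x, x \in I -> x@_0%MM = 0.

Definition cls (x : T) : A := \pi_A x.

Lemma cls_eqP x y : cls x = cls y <-> x - y \in I.
Proof. by split=> /(@quor_eqP _ I x y). Qed.

Lemma clsB x y : cls (x - y) = cls x - cls y.
Proof. exact: (raddfB (\pi_(Quotient.quot I))). Qed.

Lemma clsD x y : cls (x + y) = cls x + cls y.
Proof. exact: (raddfD (\pi_(Quotient.quot I))). Qed.

Lemma cls0 : cls 0 = 0.
Proof. exact: (raddf0 (\pi_(Quotient.quot I))). Qed.

Lemma clsM x y : cls (x * y) = cls x * cls y.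
Proof. exact: quor_pi_mul. Qed.

Lemma cls_repr a : cls (repr a) = a.
Proof. exact: reprK. Qed.

Lemma cls_sum (J : Type) (r : seq J) (Q : pred J) (F : J -> T) :
  cls (\sum_(j <- r | Q j) F j) = \sum_(j <- r | Q j) cls (F j).
Proof. by apply: big_morph; [exact: clsD | exact: cls0]. Qed.

Lemma cls_eq0 x : cls x = 0 <-> x \in I.
Proof. by rewrite -cls0 cls_eqP subr0. Qed.

Lemma pr0E (x : T) : pr 0 x = (x@_0%MM)%:MP.
Proof.
rewrite (Tle0_const (Tpc_le (prP 0 x))); congr (_%:MP).
have [N hN] := pr_dec x; rewrite {2}(hN N.+1 (leqnSn N)) big_ord_recl mcoeffD.
rewrite [X in _ = _ + X]raddf_sum [X in _ = _ + X]big1 ?addr0 // => i _;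
  apply: (dhomog_nemf_coeff (prP _ _)).
by rewrite /= mdeg0.
Qed.

Definition qpr d (a : A) : A := cls (pr d (repr a)).

Lemma qprE d x : qpr d (cls x) = cls (pr d x).
Proof.
apply/cls_eqP; rewrite -prB; apply: hI.
by apply/cls_eqP; rewrite cls_repr.
Qed.

Definition Agrading : grading (@quo_pc k S n I).
Proof.
apply: (@Grading A _ qpr).
- move=> d a b; rewrite -[a]cls_repr -[b]cls_repr -clsB !qprE prB; exact: clsB.
- by move=> d a; exists (pr d (repr a)); first exact: prP.
- move=> d e _ [t ht ->]; rewrite -[\pi_A t]/(cls t) qprE (pr_Tpc _ ht).
  by case: ifP => // _; exact: cls0.
- move=> a; have [N hN] := pr_dec (repr a); exists N => M h.
  by rewrite -{1}[a]cls_repr {1}(hN M h) cls_sum.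
- by move=> d; exists 0; [exact: Tpc0 | exact/esym/cls0].
- by exists 1; first exact: dhomog1.
- move=> d _ _ [t ht ->] [u hu ->]; exists (t - u); first exact: TpcB.
  exact/esym/clsB.
- move=> d e _ _ [t ht ->] [u hu ->]; exists (t * u); first exact: TpcM.
  exact/esym/clsM.
Defined.

Lemma augE t : aug (cls t) = t@_0%MM.
Proof. exact: aug_pi. Qed.

Lemma augB : {morph @aug k S n I : a b / a - b}.
Proof.
by move=> a b; rewrite -[a]cls_repr -[b]cls_repr -clsB !augE mcoeffB.
Qed.

Lemma augM : {morph @aug k S n I : a b / a * b}.
Proof.
by move=> a b; rewrite -[a]cls_repr -[b]cls_repr -clsM !augE rmorphM.
Qed.

Definition unit_sec (s : S) : A := cls s%:MP.

Lemma unit_secK : cancel unit_sec (@aug k S n I).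
Proof. by move=> s; rewrite augE mcoeffC eqxx mulr1. Qed.

Lemma unit_sec0 s : quo_pc 0 (unit_sec s).
Proof.
exists s%:MP => //; apply/dhomogP => mu; rewrite msuppC.
by case: eqP => // _; rewrite inE => /eqP ->; exact: mdeg0.
Qed.

Lemma unit_secD : {morph unit_sec : s t / s + t}.
Proof. by move=> s t; rewrite /unit_sec mpolyCD clsD. Qed.

Lemma qpr0 a : aug a = 0 -> qpr 0 a = 0.
Proof.
by move=> ha; rewrite /qpr pr0E -augE cls_repr ha mpolyC0 cls0.
Qed.

Section Lift.
Variables (B : choiceType) (deg : B -> nat).

Fact fcls_proof (f : fmod T B) : finite_support (fun b => cls (f b)).
Proof.
apply/asboolP; case/asboolP: (fvalP f) => s hs; exists s => b /hs ->.
exact: cls0.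
Qed.

Definition fcls f : fmod A B := Fmod (fcls_proof f).

Lemma fcls_hom m f : fmod_pc (@Tpc k S n) deg m f ->
  fmod_pc (@quo_pc k S n I) deg m (fcls f).
Proof.
move=> h b; move: (h b); rewrite /shift_pc /=; case: leqP => _.
  by move=> hb; exists (f b).
by move=> ->; exact: cls0.
Qed.

Lemma fcls_lift m (x : fmod A B) : fmod_pc (@quo_pc k S n I) deg m x ->
  exists2 f, fmod_pc (@Tpc k S n) deg m f & fcls f = x.
Proof.
(* Zero coefficients are lifted to 0, which keeps the support of the lift finite. *)
move=> hx; have h b : exists t, [/\ shift_pc (@Tpc k S n) (deg b) m t,
  cls t = x b
    & x b = 0 -> t = 0].
  have [->|nz] := pselect (x b = 0).
    by exists 0; split=> //; [exact: (shift_pc0 (@Tgrading k S n)) |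
      exact: cls0].
  move: (hx b); rewrite /shift_pc; case: leqP => _; last by move/nz.
  by case=> t ht e; exists t; split.
pose g b := projT1 (cid (h b)).
have gP b : [/\ shift_pc (@Tpc k S n) (deg b) m (g b), cls (g b) = x b &
  x b = 0 -> g b = 0].
  exact: projT2 (cid (h b)).
have gs : finite_support g.
  apply/asboolP; case/asboolP: (fvalP x) => s hs; exists s => b /hs e.
  by have [_ _] := gP b; apply.
exists (Fmod gs); first by move=> b; case: (gP b).
by apply: fmodP => b /=; case: (gP b).
Qed.

End Lift.

End QuotientAlgebra.

(** * The Jacobi condition from the vanishing of Tor_3 *)

Section Main.
Variables (k : fieldType) (S : algType k) (n : nat).
Notation T := {mpoly S[n]}.
Variables (I : twoSidedIdeal T) (R P : T -> Prop).
Hypothesis hI : graded (fun x => x \in I).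
Hypothesis hR : bimod_of_relations I R.
Hypothesis hR2 : forall x, R x -> Tge 2 x.
Hypothesis hP : subbimod P.
Hypothesis hRof : forall x, Rof P x <-> R x.
Implicit Types (x y t u : T).
Notation A := (quor I).
Notation cls := (@cls k S n I).
Notation grT := (@Tpc k S n).
Notation grA := (@quo_pc k S n I).
Let gradT := @Tgrading k S n.
Let gradA : grading grA := Agrading hI.
Let lead_I := lead_I hR hRof.
Let lead_in := @lead_in k S n I R P hR hP hRof.
Let Pfil_low := @Pfil_low k S n R P hR2 hP hRof.

(** By [lead_I], components of degree 0 of [I] are those of elements of [P_0 = 0]. *)
Lemma I_const x : x \in I -> x@_0%MM = 0.
Proof.
move=> /(lead_I 0%N)[c /Pfil_low -> //]; rewrite pr0 pr0E => /esym e.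
by have := congr1 (mcoeff 0%MM) e; rewrite mcoeff0 mcoeffC eqxx mulr1.
Qed.

(* A generator of the kernel of A(-1)^n -> A in degree sz_deg + 1, together with
   a lift to the filtration of P of the element of I that it gives. *)
Record syzygy := Syzygy {
  sz_deg : nat;
  sz_t : 'I_n -> T;
  sz_q : T;
  sz_tP : forall i, Tpc sz_deg (sz_t i);
  sz_qP : sz_q \in Pfil P sz_deg.+1;
  sz_eq : pr sz_deg.+1 sz_q = \sum_i sz_t i * 'X_i
}.

Definition syz : choiceType := {classic syzygy}.
Definition syz_deg (b : syz) : nat := (sz_deg (b : syzygy)).+1.

(** [theta] lifts the coordinates of the differential [F2 -> A^n] to [T], and [qsum] forms the same
    combination of the lifts [sz_q] to the filtration. *)
Definition theta i : fmod T syz -> T := fext (fun b : syz =>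
  sz_t (b : syzygy) i : T^o).
Definition qsum : fmod T syz -> T := fext (fun b : syz =>
  sz_q (b : syzygy) : T^o).

Lemma thetaB i f g : theta i (f - g) = theta i f - theta i g.
Proof. exact: (linearB (fext (fun b : syz => sz_t (b : syzygy) i : T^o))). Qed.
Lemma thetaZ i a f : theta i (a *: f) = a * theta i f.
Proof. exact: (linearZZ (fext (fun b : syz => sz_t (b : syzygy) i : T^o))). Qed.
Lemma thetaU i a b : theta i (fmodU a b) = a * sz_t (b : syzygy) i.
Proof. exact: (fextU (fun b : syz => sz_t (b : syzygy) i : T^o)). Qed.
Lemma qsumB f g : qsum (f - g) = qsum f - qsum g.
Proof. exact: (linearB (fext (fun b : syz => sz_q (b : syzygy) : T^o))). Qed.
Lemma qsumZ a f : qsum (a *: f) = a * qsum f.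
Proof. exact: (linearZZ (fext (fun b : syz => sz_q (b : syzygy) : T^o))). Qed.
Lemma qsumU a b : qsum (fmodU a b) = a * sz_q (b : syzygy).
Proof. exact: (fextU (fun b : syz => sz_q (b : syzygy) : T^o)). Qed.
Lemma theta0 i : theta i 0 = 0.
Proof. exact: (linear0 (fext (fun b : syz => sz_t (b : syzygy) i : T^o))). Qed.
Lemma qsum0 : qsum 0 = 0.
Proof. exact: (linear0 (fext (fun b : syz => sz_q (b : syzygy) : T^o))). Qed.

Notation Thom := (fmod_pc grT syz_deg).

Lemma theta_hom m i f : Thom m.+1 f -> Tpc m (theta i f).
Proof.
move=> hf; rewrite /theta /fext; elim/big_ind: _ => [|u v|b _];
  [exact: Tpc0 | exact: TpcD |].
move: (hf b); rewrite /shift_pc /syz_deg ltnS subSS; case: leqP => hb h.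
  by rewrite -(subnK hb); apply: TpcM => //; exact: sz_tP.
by rewrite h scale0r; exact: Tpc0.
Qed.

Lemma qsum_Pfil m f : Thom m f -> qsum f \in Pfil P m.
Proof.
move=> hf; rewrite /qsum /fext; elim/big_ind: _ => [|u v|b _];
  [exact: Pfil0 | exact: PfilD |].
move: (hf b); rewrite /shift_pc /syz_deg; case: ltnP => hb h.
  by rewrite -(subnK hb); apply: PfilMl (sz_qP _); exact: Tpc_le.
by rewrite h scale0r; exact: Pfil0.
Qed.

Lemma qsum_lead m f : Thom m.+1 f -> pr m.+1 (qsum f) = \sum_i theta i f * 'X_i.
Proof.
move=> hf; rewrite /qsum /theta /fext pr_sumT.
under [RHS]eq_bigr => i _ do rewrite mulr_suml.
rewrite exchange_big /=; apply: eq_bigr => b _.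
have -> : \sum_i f b *: (sz_t (b : syzygy) i : T^o) * 'X_i =
    f b * \sum_i sz_t (b : syzygy) i * 'X_i.
  by rewrite mulr_sumr; apply: eq_bigr => i _; rewrite mulrA.
rewrite -sz_eq; move: (hf b); rewrite /shift_pc /syz_deg; case: ltnP => hb h.
  by rewrite [_ *: _]/(f b * _) (prMl _ _ h) leq_subr subKn.
by rewrite h scale0r mul0r pr0.
Qed.

(* For f of degree m + 1 over Omega, qsum f - sum_i y_i X_i lies in P_{m+1} and
   has degree <= m; the condition is that some choice of the y_i puts it in
   P_m. *)
Definition bounded_lift m (f : fmod T syz) : Prop :=
  exists y : 'I_n -> T,
    (forall i, y i \in Pfil P m /\ pr m (y i) = theta i f) /\
    qsum f - \sum_i y i * 'X_i \in Pfil P m.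

Lemma bounded_lift0 m : bounded_lift m 0.
Proof.
exists (fun=> 0); split=> [i|]; first by rewrite theta0 pr0; split=> //;
  exact: Pfil0.
by rewrite qsum0 big1 ?subr0 => [|i _]; rewrite ?mul0r //; exact: Pfil0.
Qed.

Lemma bounded_liftB m f g : bounded_lift m f -> bounded_lift m g ->
  bounded_lift m (f - g).
Proof.
move=> [y [hy ey]] [z [hz ez]]; exists (fun i => y i - z i); split=> [i|].
  have [hy1 hy2] := hy i; have [hz1 hz2] := hz i.
  by rewrite thetaB prB hy2 hz2; split=> //; exact: PfilB.
rewrite qsumB.
have -> : \sum_i (y i - z i) * 'X_i = \sum_i y i * 'X_i - \sum_i z i * 'X_i.
  by rewrite -sumrB; apply: eq_bigr => i _; rewrite mulrBl.
have subACA (a b c d : T) : a - b - (c - d) = (a - c) - (b - d).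
  by rewrite !opprB addrACA [RHS]addrACA [- c - b]addrC.
by rewrite subACA; exact: PfilB.
Qed.

Lemma bounded_liftD m f g : bounded_lift m f -> bounded_lift m g ->
  bounded_lift m (f + g).
Proof.
move=> hf hg; rewrite -[g]opprK -[- g]sub0r; apply: bounded_liftB => //.
by apply: bounded_liftB => //; exact: bounded_lift0.
Qed.

(** Hence [bounded_lift] depends only on the class of [f] in [F2]. For a single term, the
    coefficient is the leading form of some [c] in the filtration, and [y i = c * t i] works. *)
Lemma bounded_lift_ideal m f : Thom m.+1 f -> (forall b, f b \in I) ->
  bounded_lift m f.
Proof.
move=> hf fI; rewrite (fmod_expand f); elim/big_ind: _ => [|u v|b _];
  [exact: bounded_lift0 | exact: bounded_liftD |].
rewrite -fmodUZ; move: (hf b) (fI b); rewrite /shift_pc /syz_deg ltnS subSS.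
case: leqP => hd; last by move=> -> _; rewrite (_ : fmodU 0 b = 0);
  [exact: bounded_lift0 | rewrite fmodUZ scale0r].
move: (f b) => a ha /(lead_I (m - sz_deg (b : syzygy)))[c hc].
rewrite (pr_Tpc _ ha) eqxx => ec.
move: hd hc ec ha; case: b => d t q ht hq eq /= hd hc ec ha.
exists (fun i => c * t i); split=> [i|].
  rewrite thetaU /=; split.
    by rewrite -(subnK hd); apply: PfilMr => //; exact: Tpc_le.
  rewrite -(subnK hd) prM_top ?ec ?(pr_Tpc _ (ht i)) ?eqxx //;
    first exact: Pfil_le hc.
  exact: Tpc_le.
rewrite qsumU /=.
(* With [d] the degree of [t]: [a - c] has degree below [m - d] and [q] lies in [P_{d+1}], while [c]
   lies in [P_{m-d}] and [pr d.+1 q - q] has degree at most [d]. Both products fall into [P_m]. *)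
have -> : a * q - \sum_i c * t i * 'X_i = (a - c) * q - c * (pr d.+1 q - q).
  rewrite eq mulrBl mulrBr opprB addrA subrK; congr (_ - _).
  by rewrite mulr_sumr; apply: eq_bigr => i _; rewrite mulrA.
apply: PfilB.
  have : Tlt (m - d) (a - c) by rewrite -ec; apply: pr_top; exact: Pfil_le hc.
  case e : (m - d)%N => [|j] hl.
    have -> : a - c = 0 by apply/eqP/negPn/negP => /mlead_supp /hl.
    by rewrite mul0r; exact: Pfil0.
  have -> : m = (j + d.+1)%N by lia.
  by apply: PfilMl => //; exact/Tle_lt.
by rewrite -(subnK hd); apply: PfilMr => //; apply/Tle_lt/pr_top;
  exact: Pfil_le hq.
Qed.

(* This is where (J_j) enters, with j + 1 the degree of f. *)
Lemma bounded_liftZ m i j a f : (i + j)%N = m.+1 -> (0 < i)%N -> Tpc i a ->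
  Thom j f ->
  (forall l, theta l f \in I) -> (forall j', (j' < m)%N -> jacobi P j') ->
  bounded_lift m (a *: f).
Proof.
(* Generators have degree at least 1, so an [f] of degree 0 vanishes. *)
move=> e hi ha; case: j e => [|j] e hf fI hJ.
  suff -> : f = 0 by rewrite scaler0; exact: bounded_lift0.
  by apply: fmodP => b; exact: (hf b).
have em : m = (i + j)%N by lia.
have hy l : exists y, y \in Pfil P j /\ pr j y = theta l f.
  have [c hc ec] := lead_I j (fI l); exists c; split=> //.
  by rewrite ec (pr_Tpc _ (theta_hom l hf)) eqxx.
pose y l := projT1 (cid (hy l)).
have yP l : y l \in Pfil P j /\ pr j (y l) = theta l f by exact: projT2 (cid
  (hy l)).
have hu : qsum f - \sum_l y l * 'X_l \in Pfil P j.
  have hu : qsum f - \sum_l y l * 'X_l \in Pfil P j.+1.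
    apply: PfilB; first exact: qsum_Pfil.
    by apply: Pfil_sum => l; apply: PfilMX; case: (yP l).
  (* The two leading forms cancel, so the degree is at most [j]; and [m = i + j] with [i] positive
     gives [j < m]. *)
  apply: hJ => //; first by lia.
  apply/Tle_lt; apply: Tlt_pr0; first exact: Pfil_le hu.
  rewrite prB (qsum_lead hf) pr_sumT -sumrB big1 // => l _.
  by rewrite prMX (yP l).2 subrr.
exists (fun l => a * y l); split=> [l|].
  have [hl el] := yP l; rewrite thetaZ em; split; first by apply: PfilMl =>
    //; exact: Tpc_le.
  by rewrite (prMl _ _ ha) leq_addr addKn el.
have -> : \sum_l a * y l * 'X_l = a * \sum_l y l * 'X_l.
  by rewrite mulr_sumr; apply: eq_bigr => l _; rewrite mulrA.
by rewrite qsumZ -mulrBr em; apply: PfilMl => //; exact: Tpc_le.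
Qed.

(* The generators of F2 are far from minimal; this is harmless, since Tor_3 is
   (Omega meet A^+ F2) / A^+ Omega for any choice of F2. *)
Definition F0 : grmod grA := fmod_grmod gradA (fun _ : unit => 0%N).
Definition F1 : grmod grA := fmod_grmod gradA (fun _ : 'I_n => 1%N).
Definition F2 : grmod grA := fmod_grmod gradA syz_deg.

Definition fvec (a : 'I_n -> A) : fmod A 'I_n := \sum_i fmodU (a i) i.

Lemma fvecE a i : fvec a i = a i.
Proof.
rewrite /fvec fmod_sumE (bigD1 i) //= eqxx big1 ?addr0 // => j ne.
by rewrite eq_sym (negbTE ne).
Qed.

Definition d0 : {linear F1 -> F0} := fext (fun i => fmodU (cls 'X_i) tt).
Definition d1 : {linear F2 -> F1} :=
  fext (fun b : syz => fvec (fun i => cls (sz_t (b : syzygy) i))).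

Lemma d0E (x : F1) : (d0 x : fmod A unit) tt = \sum_i (x : fmod A 'I_n) i * cls
  'X_i.
Proof.
rewrite /d0 /= (@fextE _ _ _ _ _ (enum 'I_n)) ?enum_uniq //; last first.
  by move=> b; rewrite mem_enum.
by rewrite fmod_sumE big_enum.
Qed.

Lemma d1E (f : fmod T syz) i : (d1 (fcls I f) : fmod A 'I_n) i = cls (theta i
  f).
Proof.
rewrite /d1 /= (@fextE _ _ _ _ _ (fsupp f)) ?fsupp_uniq //; last first.
  by move=> b /fsuppN e; rewrite /= e cls0.
rewrite fmod_sumE /theta /fext cls_sum; apply: eq_bigr => b _.
by rewrite fmodZE fvecE -clsM.
Qed.

Lemma d0_gr m (x : F1) : gm_pc m x -> gm_pc m (d0 x).
Proof.
move=> hx; apply: (@fext_graded _ _ 'I_n (fun=> 1%N) F0) hx => i.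
apply: (@fmod_pcU _ _ gradA unit (fun=> 0%N) tt 1%N).
by exists 'X_i => //; exact: TpcX.
Qed.

Lemma d1_gr m (x : F2) : gm_pc m x -> gm_pc m (d1 x).
Proof.
move=> hx; apply: (@fext_graded _ _ syz syz_deg F1) hx => b i.
rewrite fvecE /shift_pc /syz_deg ltn0Sn subn1 /=; eexists; [exact: sz_tP |
  by []].
Qed.

Definition stage0 : stage grA := Stage d1_gr (@fmod_projective A syz).

Definition e0 (x : F0) : S := aug ((x : fmod A unit) tt).

Fact e0_additive : zmod_morphism e0.
Proof. by move=> x y; rewrite /e0 fmodBE (augB I_const). Qed.

HB.instance Definition _ := GRing.isZmodMorphism.Build F0 S e0 e0_additive.

Lemma e0A a (x : F0) : e0 (a *: x) = aug a * e0 x.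
Proof. by rewrite /e0 fmodZE (augM I_const). Qed.

Lemma e0_gr m (x : F0) : gm_pc m.+1 x -> e0 x = 0.
Proof.
move=> /(_ tt); rewrite /shift_pc /= subn0 /e0 => -[t ht ->].
by rewrite (augE I_const); apply: (dhomog_nemf_coeff ht); rewrite /= mdeg0.
Qed.

Lemma e0_surj s : exists x : F0, e0 x = s.
Proof.
exists (fmodU (unit_sec I s) tt); rewrite /e0 fmodUE eqxx.
exact: (unit_secK I_const).
Qed.

Lemma e0_exact (x : F0) : e0 x = 0 <-> exists y : F1, x = d0 y.
Proof.
split=> [|[y ->]]; last first.
  rewrite /e0 d0E -[X in aug X]cls_repr (augE I_const).
  have -> : \sum_i (y : fmod A 'I_n) i * cls 'X_i =
     cls (\sum_i repr ((y : fmod A 'I_n) i) * 'X_i).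
    by rewrite cls_sum; apply: eq_bigr => i _; rewrite clsM cls_repr.
  rewrite -(augE I_const) cls_repr (augE I_const) raddf_sum big1 // => i _.
  rewrite /= rmorphM /= mcoeffX; case: eqP => [e|]; last by rewrite mulr0.
  by have := congr1 mdeg e; rewrite mdeg0 mdeg1.
rewrite /e0 => h; set t := repr ((x : fmod A unit) tt).
have ht : t@_0%MM = 0 by rewrite -(augE I_const) cls_repr.
have [|g [eg _]] := @div_supp _ _ _ t predT.
  move=> mu hmu; have [|i hi] := @mnm_pos _ mu; last by exists i.
  by apply: contraTneq hmu => ->; rewrite mcoeff_msupp ht eqxx.
exists (fvec (fun i => cls (g i))); apply: fmodP => -[].
rewrite d0E -[LHS]cls_repr -/t eg cls_sum; apply: eq_bigr => i _.
by rewrite fvecE clsM.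
Qed.

(** For a generator, [sum_i t_i X_i] is the leading form of an element of the filtration, hence lies
    in [I]. *)
Lemma d0d1 (x : F2) : d0 (d1 x) = 0.
Proof.
apply: fmodP => -[]; rewrite d0E.
rewrite /d1 /= /fext; under eq_bigr => i _ do rewrite fmod_sumE mulr_suml.
rewrite exchange_big /= big1 // => b _.
under eq_bigr => i _ do rewrite fvecE -mulrA -clsM.
rewrite -mulr_sumr -cls_sum -sz_eq; suff ->
  : cls (pr (sz_deg (b : syzygy)).+1 (sz_q (b : syzygy))) = 0 by rewrite mulr0.
by apply/cls_eq0; apply: lead_in; exact: sz_qP.
Qed.

(** For a homogeneous element of the kernel, [lead_I] provides the missing [q], so that its lift to
    [T] is the [t] part of a generator of [F2]. *)
Lemma d0_exact (x : F1) : d0 x = 0 <-> exists y : F2, x = d1 y.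
Proof.
split=> [|[y ->]]; last exact: d0d1.
apply: (@hom_exact _ _ F2 F1 F0) => // {x} [m x|m x hx ex]; first exact: d0_gr.
case: m hx => [|m] hx.
  by exists 0; rewrite linear0; apply: fmodP => i; exact: (hx i).
have [f hf fx] := fcls_lift hx.
have fT i : Tpc m (f i) by move: (hf i); rewrite /shift_pc /= subn1.
have fI : \sum_i f i * 'X_i \in I.
  apply/cls_eq0; rewrite cls_sum -[RHS](congr1 (fun z : fmod A unit =>
    z tt) ex) d0E -fx.
  by apply: eq_bigr => i _; rewrite clsM.
have [q hq eq] := lead_I m.+1 fI.
have fh : Tpc m.+1 (\sum_i f i * 'X_i) by apply: Tpc_sum => i; exact: TpcMX.
rewrite (pr_Tpc _ fh) eqxx in eq.
pose b : syz := Syzygy fT hq eq : syzygy.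
exists (fmodU 1 b); rewrite /d1 /= fextU scale1r -fx; apply: fmodP => i.
by rewrite fvecE.
Qed.

(** Past [F2] each term is the cover of the preceding kernel; in particular the image of [res_d 2]
    is Omega, the kernel of [d1]. *)
Definition koszul_resolution : resolution grA (@aug k S n I) :=
  build_resolution gradA (stage0 := stage0) (e :=
    e0) (@fmod_projective A _) (@fmod_projective A _)
    d0_gr e0A e0_gr e0_surj e0_exact d0_exact.


(** All lifts of the component of degree [m + 1] are considered, so that the property makes sense
    for the inhomogeneous elements produced by the vanishing of Tor and is stable under
    differences. *)
Definition bounded_class m (x : F2) : Prop :=
  forall f, Thom m.+1 f -> fcls I f = fmod_pr gradA syz_deg m.+1 x ->
    bounded_lift m f.

Lemma fclsB (f g : fmod T syz) : fcls I (f - g) = fcls I f - fcls I g.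
Proof. by apply: fmodP => b /=; exact: clsB. Qed.

Lemma fclsZ a (f : fmod T syz) : fcls I (a *: f) = cls a *: fcls I f.
Proof. by apply: fmodP => b /=; exact: clsM. Qed.

Lemma fcls_eq0 (f : fmod T syz) : fcls I f = 0 -> forall b, f b \in I.
Proof.
by move=> e b; apply/cls_eq0; exact: (congr1 (fun x : fmod A syz => x b) e).
Qed.

Lemma fmod_prB m (x y : F2) :
  fmod_pr gradA syz_deg m (x - y) = fmod_pr gradA syz_deg m x - fmod_pr gradA
    syz_deg m y.
Proof.
apply: fmodP => b /=; rewrite /shift_pr; case: ifP => _; last by rewrite subr0.
exact: grprB.
Qed.

Lemma Thom_B m f g : Thom m f -> Thom m g -> Thom m (f - g).
Proof. exact: (fmod_pcB gradT). Qed.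

Lemma bounded_class0 m : bounded_class m 0.
Proof.
move=> f hf e; apply: bounded_lift_ideal => //; apply: fcls_eq0; rewrite e.
by apply: fmodP => b /=; exact: shift_pr0.
Qed.

Lemma bounded_classB m (x y : F2) : bounded_class m x -> bounded_class m y ->
  bounded_class m (x - y).
Proof.
move=> hx hy f hf e; have [g hg eg] :=
  fcls_lift (fmod_prP gradA syz_deg m.+1 x).
rewrite -[f](subKr g); apply: bounded_liftB; first exact: hx.
apply: hy; first exact: Thom_B.
by rewrite fclsB e eg fmod_prB opprB addrC subrK.
Qed.

Lemma bounded_classD m (x y : F2) : bounded_class m x -> bounded_class m y ->
  bounded_class m (x + y).
Proof.
move=> hx hy; rewrite -[y]opprK -[- y]sub0r; apply: bounded_classB => //.
by apply: bounded_classB => //; exact: bounded_class0.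
Qed.

(** If the degrees match, [f] differs from a lift [t *: g] of [a *: x] by coefficients in [I], and
    [bounded_liftZ] applies; otherwise all coefficients of [f] lie in [I]. *)
Lemma bounded_classZ_hom m i j (a : A) (x : F2) : (0 < i)%N -> grA i a ->
  gm_pc j x ->
  d1 x = 0 -> (forall j', (j' < m)%N -> jacobi P j') ->
    bounded_class m (a *: x).
Proof.
move=> hi ha hx dx hJ f hf.
rewrite (fmod_prE gradA _ (fmod_pc_act gradA ha hx)); case: eqP => [e|_] ef;
  last first.
  by apply: bounded_lift_ideal => //; exact: fcls_eq0.
have [g hg eg] := fcls_lift hx; case: ha => t ht et.
have hl : Thom m.+1 (t *: g) by rewrite -e; exact: (fmod_pc_act gradT).
rewrite -[f](subrK (t *: g)); apply: bounded_liftD.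
  apply: bounded_lift_ideal; first exact: Thom_B.
  by apply: fcls_eq0; rewrite fclsB ef fclsZ eg et subrr.
apply: (bounded_liftZ e) => // l.
by apply/cls_eq0; rewrite -d1E eg dx.
Qed.

(** Both factors are split into components. That of degree 0 of [a] vanishes because [aug a = 0],
    and each component of [x] stays in the kernel because [d1] is graded. *)
Lemma bounded_classZ m (a : A) (x : F2) : aug a = 0 -> d1 x = 0 ->
  (forall j', (j' < m)%N -> jacobi P j') -> bounded_class m (a *: x).
Proof.
move=> ha dx hJ; have [N hN] := grpr_dec gradA a.
have [M eM] := fmod_pr_dec gradA syz_deg x.
have dxj (j : nat) : d1 (fmod_pr gradA syz_deg j x) = 0.
  have [hj|hj] := ltnP j M.
    apply: (@gm_uniq _ _ F1 M (fun j =>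
      d1 (fmod_pr gradA syz_deg j x))) hj => [i|].
      by apply: d1_gr; exact: (fmod_prP gradA).
    by rewrite -(linear_sum d1) -eM.
  suff -> : fmod_pr gradA syz_deg j x = 0 by rewrite linear0.
  apply: fmodP => b; rewrite {1}eM /= fmod_sumE shift_pr_sum big1 // => i _ /=.
  rewrite (shift_prE gradA _ (shift_prP gradA _ _ _)); case: eqP => // e.
  by have := ltn_ord i; rewrite e ltnNge hj.
rewrite (hN N.+1 (leqnSn N)) scaler_suml.
elim/big_ind: _ => [|u v|i _]; [exact: bounded_class0 |
  exact: bounded_classD |].
have a0 : grpr gradA 0 a = 0 by exact: (qpr0 (I_const)).
case: i => [[|i] hi]; first by rewrite [nat_of_ord _]/= a0 scale0r;
  exact: bounded_class0.
rewrite [nat_of_ord _]/=.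
rewrite {1}eM scaler_sumr.
elim/big_ind: _ => [|u v|j _]; [exact: bounded_class0 |
  exact: bounded_classD |].
apply: (@bounded_classZ_hom m i.+1 j) => //; first exact: (grprP gradA).
exact: (fmod_prP gradA).
Qed.

(** A Koszul syzygy with coefficient [a] of degree [m] is [a] times the generator with coordinates
    [X_j e_i - X_i e_j] and [q = 0]; for [m > 0] such an [a] has no constant term. *)
Lemma koszul_lift m f : (forall i, Tpc m.+1 (f i)) -> \sum_i f i * 'X_i = 0 ->
  exists g : fmod T syz, [/\ Thom m.+2 g, forall b, (0 < m)%N ->
    (g b)@_0%MM = 0,
    forall i, theta i g = f i & qsum g = 0].
Proof.
pose Q f := exists g : fmod T syz, [/\ Thom m.+2 g,
  forall b, (0 < m)%N -> (g b)@_0%MM = 0, forall i, theta i g = f i &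
    qsum g = 0].
move: f; apply: (koszul_ind (Q := Q)) =>
  [|f1 f2 [g1 [h1 c1 t1 q1]] [g2 [h2 c2 t2 q2]]|i j a ha].
- by exists 0; split=> [b|b _|i|]; [exact: (shift_pc0 gradT) |
  exact: mcoeff0 | exact: theta0 | exact: qsum0].
- have e : g1 + g2 = g1 - (0 - g2) by rewrite sub0r opprK.
  exists (g1 + g2); split=> [|b hm|l|].
  + by move=> b; rewrite fmodDE; exact: (shift_pcD gradT).
  + by rewrite fmodDE mcoeffD c1 // c2 // addr0.
  + by rewrite e !thetaB theta0 sub0r opprK t1 t2.
  + by rewrite e !qsumB qsum0 q1 q2 !subr0.
have ht l : Tpc 1 (koszul i j (1 : T) l) by apply: koszul_Tpc; exact: dhomog1.
have hq : (0 : T) \in Pfil P 2 by exact: Pfil0.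
have eq : pr 2 0 = \sum_l koszul i j (1 : T) l * 'X_l by rewrite pr0 koszulE.
pose b : syz := Syzygy ht hq eq : syzygy.
exists (fmodU a b); split.
- by rewrite -[m.+2]addn2; exact: (@fmod_pcU _ _ gradT syz syz_deg b m).
- move=> c hm; rewrite fmodUE; case: ifP => _; last exact: mcoeff0.
  by apply: (dhomog_nemf_coeff ha); rewrite /= mdeg0 eq_sym -lt0n.
- move=> l; rewrite thetaU /= /koszul !mul1r mulrBr.
  by congr (_ - _); case: ifP; rewrite ?mulr0.
- by rewrite qsumU /= mulr0.
Qed.

(** The class [x] of [g] lies in Omega because the [theta l g] lie in [I], and in [A^+ F2] because
    the coefficients of [g] have no constant term. The vanishing of Tor writes [x] through products
    [a *: w] with [a] in [A^+] and [w] in Omega, to which [bounded_classZ] applies. *)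
Lemma bounded_lift_of_Tor m (g : fmod T syz) : ~ Tor3_neq0 I m.+1 ->
  (forall j, (j < m)%N -> jacobi P j) ->
  Thom m.+1 g -> (forall b, (g b)@_0%MM = 0) -> (forall l, theta l g \in I) ->
  bounded_lift m g.
Proof.
move=> hT hJ hg g0 gI; set x : F2 := fcls I g.
have dx : d1 x = 0.
  by apply: fmodP => i; rewrite d1E; apply/cls_eq0.
have hx : gm_pc m.+1 x by exact: fcls_hom.
have [y hy ey] := cover_hom gradA hx dx.
have tx : tens (fun s a => s * aug a) 1 x = 0.
  rewrite (fmod_expand x) (big_morph _ (@tensDr _ _ _ _ 1) (@tensr0 _ _ _ _ 1)).
  rewrite big1 // => b _; rewrite -tensA /= (augE I_const) g0 mulr0.
  exact: tens0.
have h := @Tor_vanishing A grA S (@aug k S n I) (unit_sec I)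
  (unit_secK I_const) (@unit_sec0 k S n I) (@unit_secD k S n I)
  (augB I_const) (augM I_const) koszul_resolution 2 m.+1 y hT hy.
have {}h : x \in subgroup_of (fun z : F2 => exists a w,
  aug a = 0 /\ z = a *: cover_map gradA d1 w).
  rewrite ey; apply: h;
    rewrite -[res_d koszul_resolution 2 y]/(cover_map gradA d1 y) -ey;
      exact: tx.
suff : bounded_class m x by apply=> //; rewrite (fmod_prE gradA _ hx) eqxx.
move/asboolP: h; elim=> [|_ [a [w [ha ->]]]|u v _ hu _ hv].
- exact: bounded_class0.
- by apply: bounded_classZ => //; exact: cover_map0.
- exact: bounded_classB.
Qed.

Lemma jacobi_step m : (0 < m)%N -> ~ Tor3_neq0 I m.+1 ->
  (forall j, (j < m)%N -> jacobi P j) -> jacobi P m.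
Proof.
case: m => // m _ hT hJ x hx lx.
have [p [w [z [hp lp hw hz ex]]]] := Pfil_decomp hP hx.
have [_ _ _ hdec0 _] := hR.
have wI i : pr m.+1 (w i) \in I by exact: lead_in.
have wT i : Tpc m.+1 (pr m.+1 (w i)) by exact: prP.
have e : pr m.+2 p + \sum_i pr m.+1 (w i) * 'X_i = 0.
  have := congr1 (pr m.+2) ex; rewrite !prD (pr_lt (proj1 (Tle_lt _ _) lx)).
  rewrite (pr_lt (proj1 (Tle_lt _ _) (Pfil_le hz))) addr0 pr_sumT => /esym e.
  by rewrite -[RHS]e; congr (_ + _); apply: eq_bigr => i _; rewrite prMX.
have p0 : pr m.+2 p = 0.
  apply: hdec0; first exact: (Rof_pr hP hRof).
  move/eqP: e; rewrite addr_eq0 => /eqP ->; rewrite rpredN.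
  apply: rpred_sum => i _; apply/asboolP/SubgroupGen.
  by exists 'X_i, (pr m.+1 (w i)); split=> //; [exact: TpcX | right].
have hp' : p \in Pfil P m.+1 by apply: Pfil_P => //; apply/Tle_lt/Tlt_pr0.
rewrite p0 add0r in e.
suff hs : \sum_i w i * 'X_i \in Pfil P m.+1.
  by rewrite ex; apply: PfilD => //; exact: PfilD.
(* The first case is [(J_1)], where the [w i] lie in [P_1 = 0]. In the second, the coefficients
   given by [koszul_lift] have positive degree. *)
case: m hT hJ hx lx hw hz ex wI wT e p0 hp' lp =>
  [|m] hT hJ hx lx hw hz ex wI wT e p0 hp' lp.
  rewrite big1 => [|i _]; first exact: Pfil0.
  by rewrite (Pfil_low _ (hw i)) // mul0r.
have [g [hg g0 tg qg]] := koszul_lift wT e.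
have [|y [hy]] := bounded_lift_of_Tor hT hJ hg (g0^~ isT).
  by move=> l; rewrite tg.
rewrite qg sub0r => hY.
(* Since [qsum g = 0], the sum of the [y i * 'X_i] already has the right index. The leading forms of
   [w i] and [y i] agree, so the preceding Jacobi condition lowers the index of [w i - y i] by one,
   and multiplication by ['X_i] restores it. *)
have -> : \sum_i w i * 'X_i = \sum_i (w i - y i) * 'X_i - (- \sum_i y i * 'X_i).
  by rewrite opprK -big_split; apply: eq_bigr => i _; rewrite /= -mulrDl subrK.
apply: PfilB => //; apply: Pfil_sum => i; apply: PfilMX.
have [hyi eyi] := hy i; have hd : w i - y i \in Pfil P m.+2 by exact: PfilB.
apply: hJ => //; apply/Tle_lt; apply: Tlt_pr0; first exact: Pfil_le hd.
by rewrite prB eyi tg subrr.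
Qed.

End Main.

Theorem corollary5p30 (k : fieldType) (S : algType k) (n : nat)
    (I : twoSidedIdeal {mpoly S[n]}) (R P : {mpoly S[n]} -> Prop) :
  separable_alg S ->
  graded (fun x => x \in I) ->
  bimod_of_relations I R ->
  (forall x, R x -> Tge 2 x) ->
  subbimod P ->
  (forall x, Rof P x <-> R x) ->
  PBW_type P <->
    (complexity I = Some (-1) \/
     forall m : nat, (1 <= m)%N -> le_ext m (complexity I) -> jacobi P m).
Proof.
move=> _ hI hR hR2 hP hRof.
split=> [hPBW|hJ]; first by right=> m _ _; exact: (PBW_jacobi hR hR2 hP hRof).
(* A nonzero Tor in internal degree [m + 1] gives [m <= c(A)]. If [c(A) = -1], no such [m] exists:
   either there is no nonzero degree or the largest one is 0. *)
have {}hJ m : (0 < m)%N -> Tor3_neq0 I m.+1 -> jacobi P m.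
  move=> hm hT; have hTb : `[< Tor3_neq0 I m.+1 >] by exact/asboolP.
  move: hJ; rewrite /complexity; case: pselect => [ex|nex];
    last by case: nex; exists m.+1.
  case: pselect => [ub|nub]; last by case=> // hJ; apply: hJ.
  case: ex_maxnP => M _ hM; have hmM := hM _ hTb.
  case=> [[eM]|hJ]; last by apply: hJ => //=; lia.
  by move: eM hmM; lia.
(* Strong induction on [m]: degrees with nonzero Tor are covered by the assumption, the others
   follow from the earlier conditions, with [(J_0)] supplied by [jacobi0]. *)
apply: (jacobi_PBW hR2 hP hRof) => m; elim/ltn_ind: m => m IH hm.
have [hT|hT] := pselect (Tor3_neq0 I m.+1); first exact: hJ.
apply: (jacobi_step hI hR hR2 hP hRof) => // -[|j] hj; last exact: IH.
exact: (jacobi0 hR2 hP hRof).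
Qed.
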